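(* Let $k\ge 2$ be an integer and let $S$ be a finite subset of an abelian group $G$ such that $kS$ is aperiodic and $|kS|=k|S|-k+1$. Then there is a non-zero subgroup $H$ such that $(S\setminus S_0)+H=S\setminus S_0$, where $S_0$ is an $H$-component of $S$. Also, $|kS_0|=k|S_0|-k+1$ and $|k\phi(S)|=k|\phi(S)|-k+1$, where $\phi:G\to G/H$ denotes the canonical morphism. Moreover, one of the following holds: (1) $S_0$ is an arithmetic progression; (2) $k=2$ and $S_0=x-\big((S_0+H)\setminus S_0\big)$ for some $x$.
   Context: Notation: $A+B=\{a+b: a\in A,\ b\in B\}$ (so $\emptyset+B=\emptyset$), $x-A=\{x-a:a\in A\}$, and $kA=A+\cdots+A$ ($k$ summands). A subset $A$ of $G$ is aperiodic if $\{x\in G: x+A=A\}=\{0\}$. An arithmetic progression is a set of the form $\{a,a+d,\dots,a+(m-1)d\}$. For a subgroup $H$ of $G$, an $H$-component of $S$ is a non-empty set of the form $S\cap(x+H)$ with $x\in G$. A non-zero subgroup is a subgroup different from $\{0\}$.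
   Formalization: The group G is assumed to be non-trivial: for G={0} and S={0} the hypotheses hold, but G has no non-zero subgroup H, so the statement fails there. *)

(* Defs.v *)
From HB Require Import structures.
From mathcomp Require Import all_boot all_order all_algebra.
From mathcomp Require Import finmap all_classical.

Set Implicit Arguments.
Unset Strict Implicit.
Unset Printing Implicit Defensive.

Import GRing.Theory.
Local Open Scope ring_scope.
Local Open Scope classical_set_scope.

(* The cardinality of a finite set; [fset_set] sends infinite sets to the
   empty fset, so [set_card] is meaningless on them. *)
Definition set_card (T : choiceType) (A : set T) : nat := #|` fset_set A|%fset.

Definition translate (G : zmodType) (x : G) (A : set G) : set G :=
  [set x + a | a in A].

Definition reflection (G : zmodType) (x : G) (A : set G) : set G :=
  [set x - a | a in A].

Definition sumset (G : zmodType) (A B : set G) : set G :=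
  [set a + b | a in A & b in B].

(* A + (A + ... + A) with k summands; the value for k = 0 is {0}. *)
Definition ksumset (G : zmodType) (k : nat) (A : set G) : set G :=
  iterop k (@sumset G) A [set 0].

Definition aperiodic (G : zmodType) (A : set G) : Prop :=
  [set x | translate x A = A] = [set 0].

(* A progression has m.+1 >= 1 terms; d = 0 is allowed and gives a singleton. *)
Definition arithmetic_progression (G : zmodType) (A : set G) : Prop :=
  exists (a d : G) (m : nat), A = [set a + d *+ i | i in [set i | (i < m.+1)%N]].

Definition component (G : zmodType) (H S S0 : set G) : Prop :=
  S0 !=set0 /\ exists x : G, S0 = S `&` translate x H.

Definition quotient_map (G : zmodType) (H : zmodClosed G) (x : G) :
  Quotient.quot H := (\pi_(Quotient.quot H) x)%qT.

(* Main.v *)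
Require Import Defs.
From HB Require Import structures.
From mathcomp Require Import all_boot all_order all_algebra finmap.
From mathcomp Require Import all_classical zify.

(* Idea.  Replace [S] by a translate containing [0] and let [K] be the subgroup
   it generates.  An r-atom is a smallest set among those minimizing
   [|X + S| - |X|] over the finite [X] in [K] with [|X| >= r] and
   [|K \ (X + S)| >= r]; by submodularity of [X |-> |X + S|] and duality, two
   translates of an r-atom that share [r] points coincide.
   - If some increment [|(j+1)S| - |jS|] is at most [|S| - 2], a 1-atom is a
     non-zero finite subgroup [H] with [|S + H| <= |S| + |H| - 2].
   - Otherwise [|2S| = 2|S| - 1].  If [2S] misses a single point of [K], then
     [k = 2] and [S] is the reflection of its complement.  If not, there is a
     2-atom: it is a pair [{0, d}], and then [|(S + d) \ S| <= 1], or a subgroup,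
     or else its translates meet in at most one point.  The last case is excluded
     by looking at a 2-atom of the 2-atom, unless the subgroup [H] generated by
     the atom satisfies [|S + H| < |S| + |H|].
   When [|S + H| < |S| + |H|], the set [S] has fewer than [|H|] holes in [S + H],
   so [kS] is [H]-periodic outside a coset reached only from one component [S0];
   the unique expression bound in [G / H] then shows that [S \ S0] is
   [H]-periodic and that [S0] satisfies the hypotheses again: induct on [|S|].
   Finally, [|(S + d) \ S| = 1] means that [S] is the union of cosets of the
   subgroup generated by [d] and of one progression of difference [d]. *)

Import GRing.Theory.
Local Open Scope ring_scope.
Local Open Scope classical_set_scope.

Set Implicit Arguments.
Unset Strict Implicit.
Unset Printing Implicit Defensive.

(** * Finite sumsets, translates and subgroups *)

Section FiniteSumsets.
Local Open Scope fset_scope.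
Local Open Scope ring_scope.
Variable G : zmodType.
Implicit Types (A B C H S X Y : {fset G}) (K L : set G) (x y a b : G).

Definition sumf A B : {fset G} := [fset a + b | a in A, b in B].
Definition shift x A : {fset G} := [fset x + a | a in A].
Fixpoint nsum k A : {fset G} :=
  if k is k'.+1 then sumf A (nsum k' A) else [fset 0].

Definition aperiodicf A := forall x, shift x A = A -> x = 0.
(** Subgroups are predicates, because the subgroup generated by a finite set may be infinite. *)
Definition subgroup K := K 0 /\ forall x y, K x -> K y -> K (x - y).
Definition generated S : set G :=
  [set x | forall K, subgroup K -> (forall s, s \in S -> K s) -> K x].

Lemma sumfP A B x :
  reflect (exists a b, [/\ a \in A, b \in B & x = a + b]) (x \in sumf A B).
Proof.
apply: (iffP (imfset2P _ _ _ _ _)) => [[a aA [b bB ->]]|[a [b [aA bB ->]]]].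
  by exists a, b.
by exists a => //; exists b.
Qed.

Lemma mem_sumf A B a b : a \in A -> b \in B -> a + b \in sumf A B.
Proof. by move=> aA bB; apply/sumfP; exists a, b. Qed.

Lemma mem_shift x A y : (y \in shift x A) = (y - x \in A).
Proof.
apply/imfsetP/idP => /= [[a aA ->]|yA]; first by rewrite addrAC subrr add0r.
by exists (y - x) => //; rewrite addrC subrK.
Qed.

Lemma card_shift x A : #|` shift x A| = #|` A|.
Proof. by rewrite card_imfset //=; apply: addrI. Qed.

Lemma shift0 A : shift 0 A = A.
Proof. by apply/fsetP => y; rewrite mem_shift subr0. Qed.

Lemma shiftD x y A : shift x (shift y A) = shift (x + y) A.
Proof. by apply/fsetP => z; rewrite !mem_shift opprD addrA. Qed.

Lemma shiftN x A B : shift x A = B -> shift (- x) B = A.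
Proof. by move=> <-; rewrite shiftD addNr shift0. Qed.

Lemma shift_inj x : injective (shift x).
Proof. by move=> A B /shiftN; rewrite shiftD addNr shift0. Qed.

Lemma sub_shift_eq x A : {subset shift x A <= A} -> shift x A = A.
Proof.
move=> sA; apply/eqP; rewrite eqEfcard card_shift leqnn andbT.
by apply/fsubsetP.
Qed.

Lemma closed_shift x A : {in A, forall a, a + x \in A} -> shift x A = A.
Proof.
by move=> cA; apply: sub_shift_eq => y; rewrite mem_shift => /cA; rewrite subrK.
Qed.

Lemma sumfC A B : sumf A B = sumf B A.
Proof.
by apply/fsetP => x; apply/sumfP/sumfP => -[a [b [aA bB ->]]]; exists b, a;
  rewrite addrC.
Qed.

Lemma sumfA A B C : sumf A (sumf B C) = sumf (sumf A B) C.
Proof.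
apply/fsetP => x; apply/sumfP/sumfP => [[a [_ [aA /sumfP[b [c [bB cC ->]]] ->]]]|].
  by exists (a + b), c; rewrite addrA mem_sumf.
move=> [_ [c [/sumfP[a [b [aA bB ->]]] cC ->]]].
by exists a, (b + c); rewrite addrA mem_sumf.
Qed.

Lemma sumfS A A' B B' :
  {subset A <= A'} -> {subset B <= B'} -> {subset sumf A B <= sumf A' B'}.
Proof. by move=> sA sB _ /sumfP[a [b [aA bB ->]]]; rewrite mem_sumf ?sA ?sB. Qed.

Lemma sumf_shiftl x A B : sumf (shift x A) B = shift x (sumf A B).
Proof.
apply/fsetP => y; rewrite mem_shift; apply/sumfP/sumfP => -[a [b [aA bB e]]].
  exists (a - x), b; rewrite -mem_shift; split=> //.
  by rewrite e addrAC.
exists (x + a), b; rewrite mem_shift (addrC x) addrK; split=> //.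
by rewrite addrAC -e subrK.
Qed.

Lemma sumf_shiftr x A B : sumf A (shift x B) = shift x (sumf A B).
Proof. by rewrite sumfC sumf_shiftl sumfC. Qed.

Lemma sumf0 A : sumf A [fset 0] = A.
Proof.
apply/fsetP => x; apply/sumfP/idP => [[a [b [aA]]]|xA].
  by rewrite inE => /eqP-> ->; rewrite addr0.
by exists x, 0; rewrite inE addr0.
Qed.

Lemma subset_cardf A B : {subset A <= B} -> (#|` A| <= #|` B|)%N.
Proof. by move=> /fsubsetP; apply: fsubset_leq_card. Qed.

Lemma subset_cardf_eq A B :
  {subset A <= B} -> (#|` B| <= #|` A|)%N -> A = B.
Proof. by move=> /fsubsetP sAB cBA; apply/eqP; rewrite eqEfcard sAB. Qed.

Lemma card_disjointU A B C : {subset A <= C} -> {subset B <= C} ->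
  {in A, forall x, x \notin B} -> (#|` A| + #|` B| <= #|` C|)%N.
Proof.
move=> AC BC AB; rewrite -cardfsUI.
have -> : A `&` B = fset0.
  by apply/fsetP => x; rewrite !inE; case: (boolP (x \in A)) => // /AB /negPf.
rewrite cardfs0 addn0; apply: subset_cardf => x; rewrite inE.
by case/orP => [/AC|/BC].
Qed.

Lemma card_cover A B C : {subset C <= A `|` B} ->
  (#|` C| <= #|` A| + #|` B|)%N.
Proof. by move=> /subset_cardf; have := cardfsUI A B; lia. Qed.

Lemma card_sumfl A B b : b \in B -> (#|` A| <= #|` sumf A B|)%N.
Proof.
move=> bB; rewrite -(card_shift b A); apply: subset_cardf => y.
by rewrite mem_shift => yA; rewrite -(subrK b y) mem_sumf.
Qed.

Lemma cardf_gt0P A : reflect (exists x, x \in A) (0 < #|` A|)%N.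
Proof.
rewrite cardfs_gt0; apply: (iffP (fset0Pn _)) => -[x]; first by exists x.
by exists x.
Qed.

Lemma cardf_gt1P A :
  reflect (exists x y, [/\ x \in A, y \in A & x != y]) (1 < #|` A|)%N.
Proof.
apply: (iffP idP) => [A1|[x [y [xA yA xy]]]].
  have /cardf_gt0P[x xA] : (0 < #|` A|)%N by lia.
  have /cardf_gt0P[y] : (0 < #|` A `\ x|)%N.
    by have := cardfsD1 x A; rewrite xA; lia.
  by rewrite !inE => /andP[yx yA]; exists y, x.
have : {subset [fset x; y] <= A} by move=> z; rewrite !inE => /orP[]/eqP->.
by move/subset_cardf; rewrite cardfs2 xy.
Qed.

Lemma mem_exists_notin A B : (#|` B| < #|` A|)%N -> exists2 x, x \in A & x \notin B.
Proof.
move=> BA; have /cardf_gt0P[x] : (0 < #|` A `\` B|)%N.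
  by have := cardfsID B A; have := fsubset_leq_card (fsubsetIr A B); lia.
by rewrite inE => /andP[]; exists x.
Qed.

(** The sumset of the intersection lies in both [X + S] and [Y + S], and that of the union is their
    union; inclusion-exclusion concludes. *)
Lemma card_sumf_submod X Y S :
  (#|` sumf (X `&` Y) S| + #|` sumf (X `|` Y) S| <= #|` sumf X S| + #|` sumf Y S|)%N.
Proof.
rewrite -(cardfsUI (sumf X S)) addnC leq_add //; apply: subset_cardf => z.
  case/sumfP => a [b [+ bS ->]]; rewrite !inE.
  by case/orP => aX; apply/orP; [left|right]; rewrite mem_sumf.
case/sumfP => a [b [+ bS ->]]; rewrite !inE.
by case/andP => aX aY; rewrite !mem_sumf.
Qed.

Section Subgroup.
Variables (K : set G) (gK : subgroup K).

Lemma subgroup0 : K 0. Proof. by case: gK. Qed.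
Lemma subgroupB x y : K x -> K y -> K (x - y). Proof. by case: gK => _; apply. Qed.
Lemma subgroupN x : K x -> K (- x).
Proof. by move=> Kx; rewrite -sub0r; apply: subgroupB => //; apply: subgroup0. Qed.
Lemma subgroupD x y : K x -> K y -> K (x + y).
Proof. by move=> Kx Ky; rewrite -[y]opprK; apply/subgroupB/subgroupN. Qed.
Lemma subgroupNE x : K (- x) -> K x.
Proof. by move=> /subgroupN; rewrite opprK. Qed.
Lemma subgroupDl x y : K x -> K (x + y) -> K y.
Proof. by move=> Kx Kxy; rewrite -(addKr x y); apply: subgroupD => //; apply: subgroupN. Qed.

End Subgroup.

Lemma generated_subgroup S : subgroup (generated S).
Proof.
split=> [K gK _|x y Kx Ky K gK SK]; first exact: subgroup0.
by apply: subgroupB => //; [apply: Kx|apply: Ky].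
Qed.

Lemma mem_generated S s : s \in S -> generated S s.
Proof. by move=> sS K _; apply. Qed.

Lemma generated_sub S K : subgroup K -> (forall s, s \in S -> K s) ->
  (generated S `<=` K)%classic.
Proof. by move=> gK SK x; apply. Qed.

(** Together with [generated_sub], this extends periods from generators to the subgroup they
    generate. *)
Lemma stabilizer_subgroup A : subgroup [set x | shift x A = A].
Proof.
split=> [|x y /= ex ey] /=; first exact: shift0.
by rewrite -shiftD (shiftN ey).
Qed.

Lemma finite_subgroup L X : subgroup L -> (forall x, L x -> x \in X) ->
  exists H, (forall x, (x \in H) <-> L x) /\ subgroup [set` H].
Proof.
move=> gL LX; pose H := [fset x in X | `[< L x >]].
have HE x : (x \in H) <-> L x.
  rewrite !inE; split=> [/andP[_ /asboolP]//|Lx].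
  by rewrite LX //=; apply/asboolP.
exists H; split=> //; split=> [|x y /= xH yH] /=; apply/HE; first exact: subgroup0.
by apply: subgroupB => //; apply/HE.
Qed.

End FiniteSumsets.

(** * Fragments, duality and atoms *)

Section Atoms.
Local Open Scope fset_scope.
Local Open Scope ring_scope.
Variable G : zmodType.
Implicit Types (A B C H S X Y U : {fset G}) (K L : set G) (x y a b : G).

(** [U] witnesses that at least [r] points of [K] lie outside [X + S], which makes sense for
    infinite [K] too. *)
Definition fragment r K S X :=
  [/\ forall x, x \in X -> K x, (r <= #|` X|)%N
    & exists U, [/\ forall u, u \in U -> K u, (r <= #|` U|)%N
                  & forall u, u \in U -> u \notin sumf X S]].

Lemma shiftI x A B : shift x (A `&` B) = shift x A `&` shift x B.
Proof. by apply/fsetP => y; rewrite !(inE, mem_shift). Qed.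

Lemma fragment_shift r K S X x : subgroup K -> K x -> fragment r K S X ->
  fragment r K S (shift x X).
Proof.
move=> gK Kx [XK rX [U [UK rU UX]]]; split; rewrite ?card_shift //.
  by move=> y; rewrite mem_shift => /XK /(subgroupD gK Kx); rewrite addrC subrK.
exists (shift x U); split; rewrite ?card_shift //.
  by move=> y; rewrite mem_shift => /UK /(subgroupD gK Kx); rewrite addrC subrK.
by move=> u; rewrite sumf_shiftl !mem_shift; apply: UX.
Qed.

Lemma subset_fragment r K S X Y : {subset Y <= X} -> (r <= #|` Y|)%N ->
  fragment r K S X -> fragment r K S Y.
Proof.
move=> YX rY [XK _ [U [UK rU UX]]]; split=> // [x /YX/XK//|].
exists U; split=> // u /UX; apply: contra; exact: sumfS.
Qed.

(* The witness is [-(K \ (X + S))]. *)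
Lemma fragment_dual r K S X H : subgroup K -> (forall s, s \in S -> K s) ->
  (forall x, (x \in H) <-> K x) -> fragment r K S X ->
  exists Y, [/\ fragment r K S Y, (#|` Y| + #|` sumf X S| = #|` H|)%N
    & (#|` sumf Y S| + #|` X| <= #|` H|)%N].
Proof.
move=> gK SK HK [XK rX [U [UK rU UX]]].
have XSH : {subset sumf X S <= H}.
  by move=> _ /sumfP[a [b [aX bS ->]]]; apply/HK/(subgroupD gK); [exact: XK|exact: SK].
pose neg A : {fset G} := [fset - a | a in A].
have negE A x : (x \in neg A) = (- x \in A).
  by apply/imfsetP/idP => /= [[a aA ->]|xA]; rewrite ?opprK //; exists (- x); rewrite ?opprK.
have card_neg A : #|` neg A| = #|` A| by rewrite card_imfset //=; exact: oppr_inj.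
have YX u : u \in neg X -> u \notin sumf (neg (H `\` sumf X S)) S.
  rewrite negE => uX; apply/sumfP => -[a [b [+ bS ue]]].
  rewrite negE !inE => /andP[/negP naX _]; apply: naX.
  have -> : - a = - u + b by rewrite ue opprD subrK.
  by rewrite mem_sumf.
have negXK u : u \in neg X -> K u by rewrite negE => /XK /(subgroupNE gK).
have YK : forall x, x \in neg (H `\` sumf X S) -> K x.
  by move=> x; rewrite negE !inE => /andP[_ /HK]; apply: subgroupNE.
have cY : #|` H `\` sumf X S| = (#|` H| - #|` sumf X S|)%N.
  by rewrite cardfsDS //; apply/fsubsetP.
exists (neg (H `\` sumf X S)); split.
- split=> //.
    rewrite card_neg; apply: leq_trans rU _; apply: subset_cardf => u uU.
    by rewrite inE UX //=; apply/HK/UK.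
  by exists (neg X); rewrite card_neg; split.
- by rewrite card_neg cY subnK //; apply: subset_cardf.
- rewrite addnC -(card_neg X); apply: card_disjointU => // u.
    by move/negXK => Ku; apply/HK.
  by case/sumfP => a [b [/YK Ka /SK Kb ->]]; apply/HK/(subgroupD gK).
Qed.

(** If two distinct translates of an atom shared [r] points, their intersection would have too large
    an increment by minimality, so by submodularity their union would have too small an increment to
    be a fragment. Then [K] is finite, and counting with the dual fragment gives a contradiction. *)
Lemma atom_exists r K S X m : subgroup K -> (forall s, s \in S -> K s) ->
  (0 < #|` S|)%N -> (0 < r)%N -> fragment r K S X ->
  (#|` sumf X S| <= #|` X| + m)%N ->
  exists A, [/\ fragment r K S A, (#|` sumf A S| <= #|` A| + m)%N, 0 \in A
    & forall x, (r <= #|` A `&` shift x A|)%N -> shift x A = A].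
Proof.
move=> gK SK /cardf_gt0P[s sS] r0 fX cX.
(* The increment is minimized first, then the size. *)
pose P c := `[< exists X, fragment r K S X /\ (#|` sumf X S| <= #|` X| + c)%N >].
have exP : exists c, P c by exists m; apply/asboolP; exists X.
case: (ex_minnP exP) => c /asboolP[X1 [fX1 cX1]] minc.
pose Q n := `[< exists X, [/\ fragment r K S X, (#|` sumf X S| <= #|` X| + c)%N
  & #|` X| = n] >].
have exQ : exists n, Q n by exists #|` X1|; apply/asboolP; exists X1.
case: (ex_minnP exQ) => n /asboolP[A [fA cA cAn]] minn.
have {}minc Y d : fragment r K S Y -> (#|` sumf Y S| <= #|` Y| + d)%N -> (c <= d)%N.
  by move=> fY cY; apply: minc; apply/asboolP; exists Y.
have {}minn Y : fragment r K S Y -> (#|` sumf Y S| <= #|` Y| + c)%N ->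
    (#|` A| <= #|` Y|)%N.
  by move=> fY cY; rewrite cAn; apply: minn; apply/asboolP; exists Y.
have cm : (c <= m)%N by apply: minc fX cX.
have inter x : (r <= #|` A `&` shift x A|)%N -> shift x A = A.
  move=> rI; apply/eqP/negPn/negP => xA.
  set F := shift x A in xA rI *.
  have cF : #|` F| = #|` A| by rewrite card_shift.
  have cFS : #|` sumf F S| = #|` sumf A S| by rewrite sumf_shiftl card_shift.
  have [AK rA [U [UK rU UA]]] := fA.
  have ltI : (#|` A `&` F| < #|` A|)%N.
    rewrite ltnNge; apply: contra xA => cI; apply/eqP.
    have IA : A `&` F = A.
      by apply: subset_cardf_eq cI => y; rewrite inE => /andP[].
    by apply/esym/subset_cardf_eq; rewrite ?cF // => y; rewrite -IA inE => /andP[].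
  have cIS : (#|` A `&` F| + c < #|` sumf (A `&` F) S|)%N.
    rewrite ltnNge; apply/negP => cI.
    have : (#|` A| <= #|` A `&` F|)%N; last by rewrite leqNgt ltI.
    apply: minn => //; apply: subset_fragment fA => // y.
    by rewrite inE => /andP[].
  have cJ := cardfsUI A F.
  have sub := card_sumf_submod A F S.
  have Jle := card_sumfl (A `|` F) sS.
  have Kx : K x.
    have /cardf_gt0P[y] : (0 < #|` A `&` F|)%N by lia.
    rewrite inE mem_shift => /andP[/AK Ky /AK Kyx].
    by have := subgroupB gK Ky Kyx; rewrite opprB addrCA subrr addr0.
  have JK y : y \in A `|` F -> K y.
    rewrite inE mem_shift => /orP[/AK //|/AK Kyx].
    by rewrite -(subrK x y); apply: subgroupD.
  have JSK y : y \in sumf (A `|` F) S -> K y.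
    by case/sumfP => a [b [/JK Ka /SK Kb ->]]; apply: subgroupD.
  have noU V : (forall v, v \in V -> K v) ->
      (forall v, v \in V -> v \notin sumf (A `|` F) S) -> (#|` V| < r)%N.
    move=> VK VJ; rewrite ltnNge; apply/negP => rV.
    have fJ : fragment r K S (A `|` F).
      split=> //; first by lia.
      by exists V; split.
    (* The union has increment less than [c]; [Jle] rules out [c = 0], where [c.-1 = c]. *)
    by have := minc _ c.-1 fJ; lia.
  (* An infinite [K] would have [r] points outside the finite sumset of the union, against [noU]. *)
  have [H HK] : exists H : {fset G}, forall x, (x \in H) <-> K x.
    have [/finite_fsetP[H HE]|infK] := pselect (finite_set K).
      by exists H => y; rewrite HE.
    pose D := sumf (A `|` F) S; have infD : infinite_set (K `\` [set` D])%classic.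
      move=> finD; apply: infK.
      have : finite_set ((K `\` [set` D]) `|` [set` D])%classic.
        by rewrite finite_setU; split=> //; exact: finite_fset.
      by apply: sub_finite_set => y Ky; case: (boolP (y \in D)) => yJ;
        [right|left; split=> //; apply/negP].
    have [V VK rV] := infinite_set_fset r infD.
    have : (#|` V| < r)%N by apply: noU => v /VK[] // _ /negP.
    by rewrite ltnNge rV.
  (* The increment of [Y] is at most that of [A], so [|A| <= |Y|], that is, [|A| + |A + S| <= |H|].
     Submodularity then leaves more than [r] points of [H] outside the sumset of the union, against
     [rJ]. *)
  have [Y [fY cY cYS]] := fragment_dual gK SK HK fA.
  have cAY : (#|` A| <= #|` Y|)%N by apply: minn => //; lia.
  have rJ : (#|` H `\` sumf (A `|` F) S| < r)%N.
    by apply: noU => v; rewrite inE => /andP[] // _ /HK.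
  have cHJ := cardfsID (sumf (A `|` F) S) H.
  have HJ := fsubset_leq_card (fsubsetIr H (sumf (A `|` F) S)).
  lia.
have [AK rA _] := fA.
have /cardf_gt0P[a aA] : (0 < #|` A|)%N by lia.
exists (shift (- a) A); split.
- by apply: fragment_shift => //; exact/(subgroupN gK)/AK.
- by rewrite sumf_shiftl !card_shift; lia.
- by rewrite mem_shift sub0r opprK.
- move=> x; have -> : shift x (shift (- a) A) = shift (- a) (shift x A).
    by rewrite !shiftD addrC.
  by rewrite -shiftI card_shift => /inter ->.
Qed.

End Atoms.

(** * Multiples of a set, unique expression, periodicity outside one coset *)

Section UniqueExpression.
Local Open Scope fset_scope.
Local Open Scope ring_scope.
Variable G : zmodType.
Implicit Types (A B C H S X Y U : {fset G}) (K L : set G) (x y a b : G).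

Lemma nsum1 A : nsum 1 A = A. Proof. exact: sumf0. Qed.

Lemma nsumD i j A : nsum (i + j) A = sumf (nsum i A) (nsum j A).
Proof.
elim: i => [|i IHi] /=; first by rewrite sumfC sumf0.
by rewrite IHi sumfA.
Qed.

Lemma nsumS k A B : {subset A <= B} -> {subset nsum k A <= nsum k B}.
Proof. by move=> AB; elim: k => //= k; apply: sumfS. Qed.

Lemma nsum_shift k x A : nsum k (shift x A) = shift (x *+ k) (nsum k A).
Proof.
elim: k => [|k IHk]; first by rewrite mulr0n shift0.
by rewrite /= IHk sumf_shiftl sumf_shiftr shiftD mulrS.
Qed.

Lemma mem0_nsum k A : 0 \in A -> 0 \in nsum k A.
Proof.
move=> A0; elim: k => [|k IHk] /=; first by rewrite inE.
by rewrite -(addr0 0) mem_sumf.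
Qed.

Lemma nsum_leq i j A : 0 \in A -> (i <= j)%N -> {subset nsum i A <= nsum j A}.
Proof.
move=> A0 /subnKC <- x xi; rewrite nsumD -(addr0 x) mem_sumf //.
exact: mem0_nsum.
Qed.

Lemma nsum_in_subgroup K k A x : subgroup K -> (forall a, a \in A -> K a) ->
  x \in nsum k A -> K x.
Proof.
move=> gK AK; elim: k x => [|k IHk] x /=.
  by rewrite inE => /eqP->; apply: subgroup0.
by case/sumfP => a [b [/AK Ka /IHk Kb ->]]; apply: subgroupD.
Qed.

Lemma card_nsum_ge k A : (0 < k)%N -> (0 < #|` A|)%N -> (#|` A| <= #|` nsum k A|)%N.
Proof.
case: k => // k _ /cardf_gt0P[a aA]; rewrite -addn1 nsumD nsum1 sumfC.
have /cardf_gt0P[b bk] : (0 < #|` nsum k A|)%N; last exact: card_sumfl bk.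
apply/cardf_gt0P; exists (a *+ k); elim: k => [|k IHk] /=; first by rewrite inE.
by rewrite mulrS mem_sumf.
Qed.

Lemma sumf_subgroup H : subgroup [set` H] -> sumf H H = H.
Proof.
move=> gH; apply/fsetP => x; apply/sumfP/idP => [[a [b [aH bH ->]]]|xH].
  exact: (subgroupD gH).
by exists x, 0; rewrite addr0; split=> //; exact: (subgroup0 gH).
Qed.

Lemma nsum_sumf_subgroup H k A : subgroup [set` H] ->
  nsum k.+1 (sumf A H) = sumf (nsum k.+1 A) H.
Proof.
move=> gH; elim: k => [|k IHk]; first by rewrite !nsum1.
have nsumS B : nsum k.+2 B = sumf B (nsum k.+1 B) by [].
rewrite !nsumS IHk; move: (nsum k.+1 A) => B.
by rewrite -!sumfA; congr sumf; rewrite sumfC -sumfA sumf_subgroup.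
Qed.

Lemma aperiodicf_shift x A : aperiodicf A -> aperiodicf (shift x A).
Proof.
by move=> apA y; rewrite shiftD addrC -shiftD => /shift_inj /apA.
Qed.

(* Kemperman and Scherk's bound for the images of [A] and [B] modulo [H], by
   Dyson's transforms [A \cup (e + B), B \cap (A - e)]: they preserve the
   uniqueness of [0 = 0 + 0]. *)
Lemma card_sumf_unique H A B : subgroup [set` H] ->
  (forall a h, a \in A -> h \in H -> a + h \in A) ->
  (forall b h, b \in B -> h \in H -> b + h \in B) ->
  0 \in A -> 0 \in B -> (forall a, a \in A -> - a \in B -> a \in H) ->
  (#|` A| + #|` B| <= #|` sumf A B| + #|` H|)%N.
Proof.
move=> gH; have [n] := ubnP #|` B|; elim: n A B => // n IHn A B ltBn AH BH A0 B0 uniq.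
(* If [e + B] leaves [A], the transform at [e] removes [b] from [B], keeps the total size and does
   not enlarge the sumset. *)
have [[e eA [b bB ebA]]|noe] := pselect (exists2 e, e \in A & exists2 b, b \in B & e + b \notin A).
  pose A1 := A `|` shift e B; pose B1 := B `&` shift (- e) A.
  have cI : #|` A `&` shift e B| = #|` B1|.
    rewrite -(card_shift (- e)) shiftI shiftD addNr shift0.
    by rewrite fsetIC.
  have cAB := cardfsUI A (shift e B); rewrite cI card_shift -/A1 in cAB.
  have ltB1 : (#|` B1| < #|` B|)%N.
    have sub : {subset B1 <= B `\ b}.
      move=> x; rewrite !inE mem_shift opprK => /andP[-> xA]; rewrite andbT.
      by apply: contraNneq ebA => <-; rewrite addrC.
    by have := subset_cardf sub; have := cardfsD1 b B; rewrite bB; lia.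
  have sub1 : {subset sumf A1 B1 <= sumf A B}.
    move=> _ /sumfP[a [c [+ + ->]]]; rewrite !inE !mem_shift opprK.
    case/orP => [aA|aB] /andP[cB cA]; first exact: mem_sumf.
    have -> : a + c = (c + e) + (a - e) by rewrite addrACA subrr addr0 addrC.
    exact: mem_sumf.
  have := subset_cardf sub1.
  have : (#|` A1| + #|` B1| <= #|` sumf A1 B1| + #|` H|)%N.
    apply: IHn.
    - by lia.
    - move=> a h; rewrite !inE !mem_shift => /orP[aA|aB] hH; first by rewrite AH.
      by rewrite addrAC BH ?orbT.
    - move=> a h; rewrite !inE !mem_shift !opprK => /andP[aB aA] hH.
      by rewrite BH //= addrAC AH.
    - by rewrite inE A0.
    - by rewrite inE B0 mem_shift opprK add0r.
    - move=> a; rewrite !inE !mem_shift opprK => /orP[aA|aB] /andP[naB naA].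
        exact: uniq.
      (* Uniqueness applies first to [e - a]; periodicity of [B] then puts [- e] in [B], so it
         applies to [e] as well. *)
      have bH : - a + e \in H by apply: uniq => //; rewrite opprD opprK.
      have eH : e \in H.
        apply: uniq => //; have -> : - e = - a + (a - e) by rewrite addKr.
        apply: BH => //; rewrite -opprB [e - a]addrC.
        exact: (subgroupN gH bH).
      apply: (subgroupNE gH); apply: (subgroupDl gH eH) => /=.
      by rewrite addrC.
  by lia.
(* Without a transform, every [b] in [B] is a period of [A], so [- b] is in [A] and uniqueness puts
   [b] in [H]. *)
have AB a b : a \in A -> b \in B -> a + b \in A.
  move=> aA bB; apply/negPn/negP => abA; apply: noe.
  by exists a => //; exists b.
have BsH : {subset B <= H}.
  move=> b bB; have sA : shift b A = A by apply: closed_shift => a aA; apply: AB.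
  have nbA : - b \in A by rewrite -sub0r -mem_shift sA.
  by apply: (subgroupNE gH); apply: uniq; rewrite ?opprK.
by have := subset_cardf BsH; have := card_sumfl A B0; lia.
Qed.

(** Summands are added one at a time by [card_sumf_unique]. As [0 \in S], the smaller multiples lie
    in [kS], so a relation [a + (- a) = 0] with [a] outside [H] would contradict the hypothesis. *)
Lemma card_nsum_unique H S k : subgroup [set` H] -> 0 \in S ->
  (forall s h, s \in S -> h \in H -> s + h \in S) ->
  (forall u y, u \in S -> u \notin H -> y \in nsum k S -> u + y \notin H) ->
  (k.+1 * (#|` S| - #|` H|) + #|` H| <= #|` nsum k.+1 S|)%N.
Proof.
move=> gH S0 SH uniq.
have HS : {subset H <= S} by move=> h hH; rewrite -(add0r h) SH.
have := subset_cardf HS => cHS.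
suff : forall j, (j <= k)%N -> (j.+1 * (#|` S| - #|` H|) + #|` H| <= #|` nsum j.+1 S|)%N.
  by apply.
elim=> [|j IHj] jk; first by rewrite nsum1; lia.
have := @card_sumf_unique H S (nsum j.+1 S) gH.
have -> : sumf S (nsum j.+1 S) = nsum j.+2 S by [].
have mH a h : a \in nsum j.+1 S -> h \in H -> a + h \in nsum j.+1 S.
  by move=> /sumfP[u [v [uS vS ->]]] hH; rewrite addrAC mem_sumf // SH.
have un a : a \in S -> - a \in nsum j.+1 S -> a \in H.
  move=> aS naS; apply/negPn/negP => aH.
  have := uniq a (- a) aS aH (nsum_leq S0 jk naS).
  by rewrite subrr => /negP[]; exact: (subgroup0 gH).
move=> /(_ SH mH S0 (mem0_nsum j.+1 S0) un).
by have := IHj (ltnW jk); nia.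
Qed.

Lemma aperiodicf_not_invariant H A : aperiodicf A -> (exists2 h, h \in H & h != 0) ->
  exists a h, [/\ a \in A, h \in H & a + h \notin A].
Proof.
move=> apA [h hH h0]; apply: contrapT => nE; case/eqP: h0; apply: apA.
apply: closed_shift => a aA; apply/negPn/negP => ahA; apply: nE.
by exists a, h.
Qed.

Lemma nsum_split H S k x : x \in nsum k.+1 S ->
  x \in nsum k.+1 (S `&` H) \/
  exists u y, [/\ u \in S, u \notin H, y \in nsum k S & x = u + y].
Proof.
elim: k x => [|k IHk] x.
  rewrite !nsum1 => xS; case: (boolP (x \in H)) => xH; [left|right].
    by rewrite inE xS.
  by exists x, 0; rewrite addr0 /= inE.
rewrite -[nsum k.+2 S]/(sumf S (nsum k.+1 S)) => /sumfP[s [y [sS ySk ->]]].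
case: (boolP (s \in H)) => sH; last by right; exists s, y.
case: (IHk y ySk) => [yS0|[u [z [uS uH zS ->]]]]; [left|right].
  by apply: mem_sumf => //; rewrite inE sS.
by exists u, (s + z); rewrite addrCA; split=> //; apply: mem_sumf.
Qed.

(** A sum with a summand outside [H] lies in the multiple together with its whole coset. By
    aperiodicity the multiple misses a point of [H], so such sums avoid [H]: inside [H] only sums
    from [S] within [H] remain, and outside [H] the multiple is periodic. *)
Lemma quasiperiodic_nsum0 H S k : subgroup [set` H] ->
  (exists2 h, h \in H & h != 0) -> 0 \in S ->
  (forall u v h, u \in S -> u \notin H -> v \in S -> h \in H -> u + v + h \in sumf S S) ->
  aperiodicf (nsum k.+2 S) ->
  [/\ aperiodicf (nsum k.+2 (S `&` H)),
      (#|` nsum k.+2 S| + #|` H| = #|` nsum k.+2 (S `&` H)| + #|` sumf (nsum k.+2 S) H|)%N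
    & (k.+2 * #|` sumf (S `\` H) H| + #|` H| <= #|` sumf (nsum k.+2 S) H|)%N].
Proof.
move=> gH nzH S0 per2 apS.
have H0 : 0 \in H := subgroup0 gH.
have S0H : forall x, x \in nsum k.+2 (S `&` H) -> x \in H.
  by move=> x; apply: (nsum_in_subgroup gH) => a; rewrite inE => /andP[].
have S0S : {subset nsum k.+2 (S `&` H) <= nsum k.+2 S}.
  by apply: nsumS => x; rewrite inE => /andP[].
have per u y h : u \in S -> u \notin H -> y \in nsum k.+1 S -> h \in H ->
    u + y + h \in nsum k.+2 S.
  move=> uS uH /sumfP[v [z [vS zS ->]]] hH.
  have -> : u + (v + z) + h = (u + v + h) + z by rewrite addrA [LHS]addrAC.
  have -> : nsum k.+2 S = sumf (sumf S S) (nsum k S) by rewrite -sumfA.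
  by apply: mem_sumf => //; apply: per2.
have HnS : exists2 h, h \in H & h \notin nsum k.+2 S.
  have [a [h [aS hH ahS]]] := aperiodicf_not_invariant apS nzH.
  case: (nsum_split H aS) => [/S0H aH|[u [y [uS uH yS e]]]].
    by exists (a + h) => //; apply: (subgroupD gH).
  by move: ahS; rewrite e per.
have uniq u y : u \in S -> u \notin H -> y \in nsum k.+1 S -> u + y \notin H.
  move=> uS uH yS; apply/negP => uyH; case: HnS => h hH /negP; apply.
  have -> : h = u + y + (h - (u + y)) by rewrite addrC subrK.
  by apply: per => //; exact: (subgroupB gH hH uyH).
have inS0 x : x \in nsum k.+2 S -> x \in H -> x \in nsum k.+2 (S `&` H).
  move=> xS xH; case: (nsum_split H xS) => // -[u [y [uS uH yS e]]].
  by have := uniq _ _ uS uH yS; rewrite -e xH.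
have IE : nsum k.+2 S `&` H = nsum k.+2 (S `&` H).
  apply/fsetP => x; rewrite inE; apply/andP/idP => [[]|xS0]; first exact: inS0.
  by rewrite S0S ?S0H.
have perD x h : x \in nsum k.+2 S -> x \notin H -> h \in H -> x + h \in nsum k.+2 S.
  move=> xS xH hH; case: (nsum_split H xS) => [/S0H xH'|[u [y [uS uH yS ->]]]].
    by rewrite xH' in xH.
  exact: per.
have HD x h : x \notin H -> h \in H -> x + h \notin H.
  move=> xH hH; apply: contra xH => xhH.
  by apply: (subgroupDl gH hH); rewrite addrC.
have sumE : sumf (nsum k.+2 S) H = H `|` (nsum k.+2 S `\` H).
  apply/fsetP => x; rewrite !inE; apply/sumfP/idP.
    move=> [a [h [aS hH ->]]]; case: (boolP (a \in H)) => aH.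
      by rewrite (subgroupD gH aH hH : a + h \in H).
    by rewrite (negPf (HD _ _ aH hH)) perD.
  case/orP => [xH|/andP[_ xS]]; last by exists x, 0; rewrite addr0.
  by exists 0, x; rewrite add0r mem0_nsum.
split.
- move=> x xS0; apply: apS; apply: closed_shift => y yS.
  have xH : x \in H.
    have y0 : 0 \in nsum k.+2 (S `&` H).
      by apply: mem0_nsum; rewrite inE S0.
    by apply: S0H; rewrite -xS0 mem_shift subrr.
  case: (boolP (y \in H)) => yH; last exact: perD.
  apply: S0S; rewrite -xS0 mem_shift addrK; exact: inS0.
- rewrite sumE -(cardfsID H (nsum k.+2 S)) IE.
  have -> : #|` H `|` (nsum k.+2 S `\` H)| = (#|` H| + #|` nsum k.+2 S `\` H|)%N.
    rewrite -cardfsUI; have -> : H `&` (nsum k.+2 S `\` H) = fset0.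
      by apply/fsetP => x; rewrite !inE; case: (x \in H).
    by rewrite cardfs0 addn0.
  by lia.
(* The unique expression bound is applied to [S + H], which contains the disjoint sets [H] and
   [(S \ H) + H]. *)
- have := @card_nsum_unique H (sumf S H) k.+1 gH.
  rewrite !nsum_sumf_subgroup //.
  have S'0 : 0 \in sumf S H by rewrite -(addr0 0) mem_sumf.
  have S'H s h : s \in sumf S H -> h \in H -> s + h \in sumf S H.
    case/sumfP => a [b [aS bH ->]] hH; rewrite -addrA mem_sumf //.
    exact: (subgroupD gH).
  have un u y : u \in sumf S H -> u \notin H -> y \in sumf (nsum k.+1 S) H -> u + y \notin H.
    case/sumfP => a [h [aS hH ->]] ahH /sumfP[b [h' [bS h'H ->]]].
    rewrite addrACA; apply: HD; last exact: (subgroupD gH).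
    apply: uniq => //; apply: contra ahH => aH; exact: (subgroupD gH).
  move=> /(_ S'0 S'H un) /(leq_trans _); apply; rewrite leq_add2r leq_mul2l /=.
  have := @card_disjointU G H (sumf (S `\` H) H) (sumf S H); rewrite leq_subRL; last first.
    by apply: subset_cardf => h hH; rewrite -(add0r h) mem_sumf.
  apply.
  + by move=> h hH; rewrite -(add0r h) mem_sumf.
  + by apply: sumfS => // x; rewrite inE => /andP[].
  + move=> x xH; apply/sumfP => -[a [h [+ hH e]]]; rewrite inE => /andP[aH _].
    by move/negP: (HD _ _ aH hH); apply; rewrite -e.
Qed.

Lemma shiftDf x A B : shift x (A `\` B) = shift x A `\` shift x B.
Proof. by apply/fsetP => y; rewrite !(inE, mem_shift). Qed.

(** Translation by [- s0] moves the exceptional coset to [H]. *)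
Lemma quasiperiodic_nsum H S s0 k : subgroup [set` H] ->
  (exists2 h, h \in H & h != 0) -> s0 \in S ->
  (forall u v h, u \in S -> u \notin shift s0 H -> v \in S -> h \in H ->
     u + v + h \in sumf S S) ->
  aperiodicf (nsum k.+2 S) ->
  [/\ aperiodicf (nsum k.+2 (S `&` shift s0 H)),
      (#|` nsum k.+2 S| + #|` H| =
         #|` nsum k.+2 (S `&` shift s0 H)| + #|` sumf (nsum k.+2 S) H|)%N
    & (k.+2 * #|` sumf (S `\` shift s0 H) H| + #|` H| <= #|` sumf (nsum k.+2 S) H|)%N].
Proof.
move=> gH nzH s0S per2 apS.
have := @quasiperiodic_nsum0 H (shift (- s0) S) k gH nzH.
have -> : shift (- s0) S `&` H = shift (- s0) (S `&` shift s0 H).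
  by rewrite shiftI shiftD addNr shift0.
have -> : shift (- s0) S `\` H = shift (- s0) (S `\` shift s0 H).
  by rewrite shiftDf shiftD addNr shift0.
rewrite !nsum_shift !sumf_shiftl !card_shift mem_shift sub0r opprK.
case=> //; last by (move=> apS0 -> ->; split=> //;
  have := aperiodicf_shift (x := s0 *+ k.+2) apS0; rewrite shiftD mulNrn subrr shift0).
  move=> u v h; rewrite sumf_shiftr !mem_shift !opprK => uS uH vS hH.
  have -> : u + v + h + s0 + s0 = (u + s0) + (v + s0) + h.
    by rewrite [u + s0 + _]addrACA [RHS]addrAC addrA.
  by apply: per2 => //; rewrite mem_shift addrK.
exact: aperiodicf_shift.
Qed.

(* Fewer than [|H|] holes: two cosets of [H] cannot both have half of their
   elements missing from [S]. *)
Lemma few_holes H S k : subgroup [set` H] -> (exists2 h, h \in H & h != 0) ->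
  (#|` sumf S H| < #|` S| + #|` H|)%N -> aperiodicf (nsum k.+2 S) ->
  exists2 s0, s0 \in S & forall u v h, u \in S -> u \notin shift s0 H ->
    v \in S -> h \in H -> u + v + h \in sumf S S.
Proof.
move=> gH nzH holes apS.
have same s t : s - t \in H -> forall x, (x \in shift s H) = (x \in shift t H).
  move=> stH x; rewrite !mem_shift; apply/idP/idP => xH.
    by have := subgroupD gH xH stH; rewrite addrA subrK.
  by have := subgroupB gH xH stH; rewrite opprB addrA subrK.
(* The holes in two distinct cosets are disjoint, hence fewer than [|H|] altogether. *)
have hole_le s t : s \in S -> t \in S -> t \notin shift s H ->
    (#|` H| < #|` S `&` shift s H| + #|` S `&` shift t H|)%N.
  move=> sS tS tsH; have Hle u := fsubset_leq_card (fsubsetIr (shift u H) S).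
  have cs u := cardfsID S (shift u H).
  have dis : (#|` S| + #|` (shift s H `\` S) `|` (shift t H `\` S)| <= #|` sumf S H|)%N.
    apply: card_disjointU => [x xS|x|x xS].
    - by rewrite -(addr0 x) mem_sumf //; exact: (subgroup0 gH).
    - rewrite !inE !mem_shift => /orP[]/andP[_ xH].
        by rewrite -(subrK s x) addrC mem_sumf.
      by rewrite -(subrK t x) addrC mem_sumf.
    - by rewrite !inE xS.
  have cU := cardfsUI (shift s H `\` S) (shift t H `\` S).
  have I0 : (shift s H `\` S) `&` (shift t H `\` S) = fset0.
    apply/fsetP => x; rewrite !inE; apply/negP => /andP[/andP[_ xs] /andP[_ xt]].
    case/negP: tsH; rewrite !mem_shift in xs xt *.
    by have := subgroupB gH xs xt; rewrite opprB [x - s]addrC addrACA subrr addr0 addrC.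
  rewrite I0 cardfs0 in cU.
  have := cs s; have := cs t; rewrite !card_shift ![_ `&` S]fsetIC.
  by lia.
(* The map [y |-> s + t + h - y] sends the part of [S] in [t + H] to holes of [s + H]. *)
have full s t h : s \in S -> t \in S -> h \in H -> s + t + h \notin sumf S S ->
    (#|` S `&` shift s H| + #|` S `&` shift t H| <= #|` H|)%N.
  move=> sS tS hH nst.
  pose refl := [fset s + t + h - y | y in S `&` shift t H].
  have -> : #|` S `&` shift t H| = #|` refl|.
    by rewrite [RHS]card_imfset // => y z /addrI /oppr_inj.
  rewrite -(card_shift s H); apply: card_disjointU => x.
  - by rewrite inE => /andP[].
  - case/imfsetP => /= y; rewrite inE !mem_shift => /andP[_ yH] ->.
    have -> : s + t + h - y - s = h - (y - t).
      by rewrite opprB -!addrA [LHS]addrC -!addrA addNr addr0 addrCA.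
    exact: (subgroupB gH).
  - rewrite inE => /andP[xS _]; apply/negP => /imfsetP[/= y].
    rewrite inE => /andP[yS _] e; case/negP: nst.
    by rewrite -(subrK y (s + t + h)) -e mem_sumf.
have [a [h [aS hH ahS]]] := aperiodicf_not_invariant apS nzH.
have [s [t [sS tS [z zS ae]]]] : exists s t, [/\ s \in S, t \in S
    & exists2 z, z \in nsum k S & a = s + t + z].
  move: aS; rewrite -[nsum k.+2 S]/(sumf S (sumf S (nsum k S))) sumfA.
  by case/sumfP => _ [z [/sumfP[s [t [sS tS ->]]] zS ->]]; exists s, t; split=> //; exists z.
have nst : s + t + h \notin sumf S S.
  apply: contra ahS => sth; rewrite ae addrAC.
  by rewrite -[nsum k.+2 S]/(sumf S (sumf S (nsum k S))) sumfA mem_sumf.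
have tH : t \in shift s H.
  apply/negPn/negP => tH; have := hole_le _ _ sS tS tH.
  by rewrite ltnNge (full s t h).
(* The coset [s + H] is at most half full. A missing sum starting outside it would give a second
   coset at most half full, against [hole_le]. *)
exists s => // u v g uS uH vS gH'; apply/negPn/negP => nuv.
have vH : v \in shift u H.
  apply/negPn/negP => vH; have := hole_le _ _ uS vS vH.
  by rewrite ltnNge (full u v g).
have es : S `&` shift t H = S `&` shift s H.
  by apply/fsetP => x; rewrite !inE (same t s) // -mem_shift.
have eu : S `&` shift v H = S `&` shift u H.
  by apply/fsetP => x; rewrite !inE (same v u) // -mem_shift.
have := full _ _ _ sS tS hH nst; have := full _ _ _ uS vS gH' nuv.
have := hole_le _ _ sS uS uH.
by rewrite es eu; lia.
Qed.

End UniqueExpression.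

(** * Subgroups from small increments, and Kneser's bound *)

Section Reduction.
Local Open Scope fset_scope.
Local Open Scope ring_scope.
Variable G : zmodType.
Implicit Types (A B C H S X Y U : {fset G}) (K L : set G) (x y a b : G).

Lemma period_closed_subgroup A : 0 \in A ->
  (forall a, a \in A -> shift a A = A) -> subgroup [set` A].
Proof. by move=> A0 pA; split=> //= x y xA yA; rewrite -mem_shift pA. Qed.

Lemma cardf_gt1_neq0 A : (1 < #|` A|)%N -> exists2 a, a \in A & a != 0.
Proof.
case/cardf_gt1P => x [y [xA yA xy]]; case: (eqVneq x 0) => [x0|]; last by exists x.
by exists y => //; rewrite eq_sym -x0.
Qed.

(** A 1-atom [A] containing [0] meets [a + A] in [a] for each [a] in [A], so all these translates
    equal [A], which is thus a subgroup. It is non-zero because [|S + A| >= |S|]. *)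
Lemma subgroup_fragment K S X : subgroup K -> (forall s, s \in S -> K s) ->
  (0 < #|` S|)%N -> fragment 1 K S X -> (#|` sumf X S| + 1 < #|` X| + #|` S|)%N ->
  exists H, [/\ subgroup [set` H], exists2 h, h \in H & h != 0,
    (#|` sumf S H| + 1 < #|` S| + #|` H|)%N & exists2 u, K u & u \notin sumf S H].
Proof.
move=> gK SK S0 fX cX.
have [s sS] := cardf_gt0P _ S0; have XXS := card_sumfl X sS.
(* The subtraction is exact: [XXS] and [cX] force [|S| >= 2]. *)
have cX' : (#|` sumf X S| <= #|` X| + (#|` S| - 2))%N by lia.
have [A [[_ _ [U [UK rU UA]]] cA A0 pA]] := atom_exists gK SK S0 (ltn0Sn 0) fX cX'.
exists A; have gA : subgroup [set` A].
  apply: period_closed_subgroup => // a aA; apply: pA.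
  by apply/cardf_gt0P; exists a; rewrite inE aA mem_shift subrr.
have SSA := card_sumfl S A0; rewrite sumfC in cA.
split=> //; last 1 first.
- by have [u uU] := cardf_gt0P _ rU; exists u; [exact: UK|rewrite sumfC UA].
- by apply: cardf_gt1_neq0; lia.
- by lia.
Qed.

(** Otherwise [H], which lies in [S + H], would contain the whole generated subgroup. *)
Lemma not_sub_subgroup H S : subgroup [set` H] -> 0 \in S ->
  (exists2 u, generated S u & u \notin sumf S H) -> exists2 t, t \in S & t \notin H.
Proof.
move=> gH S0 [u Ku uSH]; apply: contrapT => nE; case/negP: uSH.
rewrite -(add0r u) mem_sumf //; apply: (Ku _ gH) => s sS.
by apply/negPn/negP => sH; apply: nE; exists s.
Qed.

Lemma nsum_generated k S x : x \in nsum k S -> generated S x.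
Proof. apply: nsum_in_subgroup; [exact: generated_subgroup|exact: mem_generated]. Qed.

Lemma aperiodicf_not_full k S : (1 < #|` S|)%N -> aperiodicf (nsum k S) ->
  exists2 u, generated S u & u \notin nsum k S.
Proof.
move=> /cardf_gt1_neq0[s sS s0] apS.
have nzs : exists2 h, h \in [fset s] & h != 0 by exists s; rewrite ?inE.
have [a [h [aS /[!inE]/eqP-> ahS]]] := aperiodicf_not_invariant apS nzs.
exists (a + s) => //; apply: (subgroupD (generated_subgroup S)).
  exact: nsum_generated aS.
exact: mem_generated.
Qed.

Lemma nsum_increments S i n :
  (forall j, (i <= j < i + n)%N -> (#|` nsum j S| + #|` S| <= #|` nsum j.+1 S| + 1)%N) ->
  (#|` nsum i S| + n * #|` S| <= #|` nsum (i + n) S| + n)%N.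
Proof.
elim: n => [|n IHn] inc; first by rewrite !addn0.
have /IHn : forall j, (i <= j < i + n)%N -> (#|` nsum j S| + #|` S| <= #|` nsum j.+1 S| + 1)%N.
  by move=> j ij; apply: inc; lia.
by have := inc (i + n)%N; rewrite -addnS; lia.
Qed.

(** This is the induction step: [few_holes] provides the exceptional component, and [|H|] cancels
    between the exact count and the unique expression bound. *)
Lemma quasiperiodic_reduction H S k : subgroup [set` H] ->
  (exists2 h, h \in H & h != 0) -> (#|` sumf S H| < #|` S| + #|` H|)%N ->
  0 \in S -> (exists2 t, t \in S & t \notin H) -> aperiodicf (nsum k.+2 S) ->
  exists s0, [/\ s0 \in S, (#|` S `&` shift s0 H| < #|` S|)%N,
    aperiodicf (nsum k.+2 (S `&` shift s0 H))
  & (#|` nsum k.+2 (S `&` shift s0 H)| + k.+2 * #|` sumf (S `\` shift s0 H) H|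
     <= #|` nsum k.+2 S|)%N].
Proof.
move=> gH nzH holes S0 [t tS tH] apS.
have [s0 s0S per2] := few_holes gH nzH holes apS.
have [apS0 c1 c2] := quasiperiodic_nsum gH nzH s0S per2 apS.
exists s0; split=> //; last by lia.
rewrite ltnNge; apply/negP => /(subset_cardf_eq (fsubsetP (fsubsetIl _ _))) SE.
have inH x : x \in S -> x - s0 \in H by rewrite -SE inE mem_shift => /andP[].
case/negP: tH; have := subgroupB gH (inH _ tS) (inH _ S0).
by rewrite sub0r opprK /= subrK.
Qed.

(** The set [jS] is a 1-fragment, since [(j+1)S] lies in the aperiodic multiple, which misses a
    point of the generated subgroup. *)
Lemma small_increment_subgroup k S j : 0 \in S -> (1 < #|` S|)%N ->
  aperiodicf (nsum k.+2 S) -> (1 <= j < k.+2)%N ->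
  (#|` nsum j.+1 S| + 1 < #|` nsum j S| + #|` S|)%N ->
  exists H, [/\ subgroup [set` H], exists2 h, h \in H & h != 0,
    (#|` sumf S H| < #|` S| + #|` H|)%N & exists2 t, t \in S & t \notin H].
Proof.
move=> S0 S1 apS jk inc.
have fX : fragment 1 (generated S) S (nsum j S).
  split=> [x||]; first exact: nsum_generated.
    by apply/cardf_gt0P; exists 0; apply: mem0_nsum.
  have [u Ku uS] := aperiodicf_not_full S1 apS.
  exists [fset u]; rewrite cardfs1; split=> // v; rewrite inE => /eqP-> //.
  apply: contra uS; rewrite sumfC; apply: (@nsum_leq _ j.+1 k.+2) => //; lia.
have [H [gH nzH holes uH]] : exists H, [/\ subgroup [set` H], exists2 h, h \in H & h != 0,
    (#|` sumf S H| + 1 < #|` S| + #|` H|)%N & exists2 u, generated S u & u \notin sumf S H].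
  apply: subgroup_fragment fX _; [exact: generated_subgroup|exact: mem_generated|lia|].
  by rewrite sumfC.
exists H; split=> //; first by lia.
exact: not_sub_subgroup.
Qed.

(** Kneser's theorem for aperiodic multiples. If all increments are at least [|S| - 1], they
    telescope; otherwise a subgroup with few holes reduces the bound to one component of [S]. *)
Theorem nsum_kneser k S : (0 < #|` S|)%N -> aperiodicf (nsum k.+2 S) ->
  (k.+2 * #|` S| <= #|` nsum k.+2 S| + k.+1)%N.
Proof.
have [n] := ubnP #|` S|; elim: n S => // n IHn S ltSn /cardf_gt0P[s sS] apS.
wlog S0 : S s sS ltSn apS / 0 \in S.
  move/(_ (shift (- s) S) 0); rewrite nsum_shift !card_shift mem_shift sub0r opprK.
  by apply=> //; apply: aperiodicf_shift.
have [S1|S1] := leqP #|` S| 1.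
  have : (0 < #|` nsum k.+2 S|)%N by apply/cardf_gt0P; exists 0; apply: mem0_nsum.
  by nia.
rewrite leqNgt; apply/negP => small.
have [[j jk inc]|noj] := pselect (exists2 j, (1 <= j < k.+2)%N &
    (#|` nsum j.+1 S| + 1 < #|` nsum j S| + #|` S|)%N); last first.
  have : forall j, (1 <= j < 1 + k.+1)%N -> (#|` nsum j S| + #|` S| <= #|` nsum j.+1 S| + 1)%N.
    by move=> j jk; rewrite leqNgt; apply/negP => inc; apply: noj; exists j.
  by move/nsum_increments; rewrite nsum1 add1n; lia.
have [H [gH nzH holes tH]] := small_increment_subgroup S0 S1 apS jk inc.
have [s0 [s0S ltS0 apS0 cS]] := quasiperiodic_reduction gH nzH holes S0 tH apS.
have := IHn (S `&` shift s0 H) => /(_ _ _ apS0).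
have -> : (0 < #|` S `&` shift s0 H|)%N.
  apply/cardf_gt0P; exists s0; rewrite inE s0S mem_shift subrr; exact: (subgroup0 gH).
move=> /(_ (leq_trans ltS0 ltSn) isT).
have := cardfsID (shift s0 H) S.
have := card_sumfl (S `\` shift s0 H) (subgroup0 gH : 0 \in H).
by nia.
Qed.

End Reduction.

(** * Two-atoms and sparse sets *)

Section TwoAtoms.
Local Open Scope fset_scope.
Local Open Scope ring_scope.
Variable G : zmodType.
Implicit Types (A B C H S X Y U M : {fset G}) (K L : set G) (x y a b : G).

(** These are the Sidon sets: a non-zero difference comes from at most one pair. *)
Definition sparse A := forall x, x != 0 -> (#|` A `&` shift x A| <= 1)%N.

(** If [A] and [x + A] share two points for some non-zero [x], then [x] is a period of [A]. Each [a]
    in [A] is then a period too, because [a] and [a + x] both lie in [A] and in [a + A]. *)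
Lemma two_atom K S X : subgroup K -> (forall s, s \in S -> K s) ->
  (0 < #|` S|)%N -> fragment 2 K S X -> (#|` sumf X S| < #|` X| + #|` S|)%N ->
  exists A, [/\ fragment 2 K S A, (#|` sumf A S| < #|` A| + #|` S|)%N, 0 \in A
    & subgroup [set` A] \/ sparse A].
Proof.
move=> gK SK S0 fX cX.
have cX' : (#|` sumf X S| <= #|` X| + #|` S|.-1)%N by lia.
have [A [fA cA A0 pA]] := atom_exists gK SK S0 (ltn0Sn 1) fX cX'.
exists A; split=> //; first by lia.
have [[x x0 xA]|nox] := pselect (exists2 x, x != 0 & (1 < #|` A `&` shift x A|)%N); last first.
  by right=> x x0; rewrite leqNgt; apply/negP => xA; apply: nox; exists x.
have {}xA := pA x xA.
have inA y : y \in A -> y + x \in A by move=> yA; rewrite -xA mem_shift addrK.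
left; apply: period_closed_subgroup => // a aA; apply: pA.
apply/cardf_gt1P; exists a, (a + x); rewrite !inE !mem_shift subrr aA A0 inA //.
rewrite [a + x]addrC addrK -[x]add0r inA // add0r; split=> //.
by rewrite -subr_eq0 opprD addrCA subrr addr0 oppr_eq0.
Qed.

(** If [t] in [A] were outside [H], then [A + H] would contain [H] and [t + H], giving [|H| < |A|];
    it also contains [A] and [x + A], which by sparsity gives [|A| <= |H|]. *)
Lemma sparse_sub_subgroup A H : sparse A -> subgroup [set` H] ->
  (exists2 h, h \in H & h != 0) -> 0 \in A ->
  (#|` sumf A H| < #|` A| + #|` H|)%N -> {subset A <= H}.
Proof.
move=> spA gH [x xH x0] A0 cAH t tA; apply/negPn/negP => tH.
have c2 : (#|` H| + #|` shift t H| <= #|` sumf A H|)%N.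
  apply: card_disjointU => y.
  - by move=> yH; rewrite -(add0r y) mem_sumf.
  - by rewrite mem_shift => yH; rewrite -(subrK t y) addrC mem_sumf.
  - move=> yH; rewrite mem_shift; apply: contra tH => ytH.
    by have := subgroupB gH yH ytH; rewrite opprB addrC subrK.
have : (#|` A `|` shift x A| <= #|` sumf A H|)%N.
  apply: subset_cardf => y; rewrite inE mem_shift => /orP[yA|yA].
    by rewrite -(addr0 y) mem_sumf //; exact: (subgroup0 gH).
  by rewrite -(subrK x y) mem_sumf.
have := cardfsUI A (shift x A); have := spA x x0; move: c2; rewrite !card_shift.
by lia.
Qed.

Lemma sparse_shifts A a b : sparse A -> a != b -> (#|` shift a A `&` shift b A| <= 1)%N.
Proof.
move=> spA ab; rewrite -(card_shift (- a)) shiftI !shiftD addNr shift0.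
by apply: spA; rewrite addrC subr_eq0 eq_sym.
Qed.

Lemma shift_sub_sumf A B b : b \in B -> {subset shift b A <= sumf A B}.
Proof. by move=> bB y; rewrite mem_shift => yA; rewrite -(subrK b y) mem_sumf. Qed.

Lemma card_sparse_sumf2 A B : sparse A -> (1 < #|` B|)%N ->
  (2 * #|` A| <= #|` sumf A B| + 1)%N.
Proof.
move=> spA /cardf_gt1P[a [b [aB bB ab]]].
have : (#|` shift a A `|` shift b A| <= #|` sumf A B|)%N.
  by apply: subset_cardf => y; rewrite inE => /orP[]; apply: shift_sub_sumf.
have := cardfsUI (shift a A) (shift b A); have := sparse_shifts spA ab.
by rewrite !card_shift; lia.
Qed.

Lemma card_sparse_sumf3 A B : sparse A -> (2 < #|` B|)%N ->
  (3 * #|` A| <= #|` sumf A B| + 3)%N.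
Proof.
move=> spA B3; have /cardf_gt1P[a [b [aB bB ab]]] := ltnW B3.
have [|c cB] := @mem_exists_notin _ B [fset a; b]; first by rewrite cardfs2 ab.
rewrite !inE negb_or => /andP[ca cb].
have : (#|` shift a A `|` shift b A `|` shift c A| <= #|` sumf A B|)%N.
  by apply: subset_cardf => y; rewrite !inE => /orP[/orP[]|]; apply: shift_sub_sumf.
have := cardfsUI (shift a A) (shift b A); have := sparse_shifts spA ab.
have := cardfsUI (shift a A `|` shift b A) (shift c A).
have := sparse_shifts spA ca; have := sparse_shifts spA cb.
have : (#|` (shift a A `|` shift b A) `&` shift c A| <=
    #|` shift c A `&` shift a A| + #|` shift c A `&` shift b A|)%N.
  by apply: card_cover => y; rewrite !inE andbC andb_orr.
by rewrite !card_shift; lia.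
Qed.

(** A smaller sumset would give a subgroup with few holes for [A]; by sparsity it contains [A],
    hence the whole generated subgroup. *)
Lemma sparse_fragment1 A X : sparse A -> 0 \in A ->
  fragment 1 (generated A) A X -> (#|` X| + #|` A| <= #|` sumf X A| + 1)%N.
Proof.
move=> spA A0 fX; rewrite leqNgt; apply/negP => cX.
have cA0 : (0 < #|` A|)%N by apply/cardf_gt0P; exists 0.
have [H [gH nzH cH uH]] := subgroup_fragment (generated_subgroup A) (@mem_generated _ A) cA0 fX cX.
have [t tA /negP[]] := not_sub_subgroup gH A0 uH.
by apply: (sparse_sub_subgroup spA gH nzH A0) => //; lia.
Qed.

(* A 2-atom of a sparse set [A] is sparse too, hence as large as [A] and
   conversely, and three translates already have too large a union. *)
Lemma sparse_fragment2 A X : sparse A -> 0 \in A -> (2 < #|` A|)%N ->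
  fragment 2 (generated A) A X -> (#|` X| + #|` A| <= #|` sumf X A|)%N.
Proof.
move=> spA A0 A3 fX; rewrite leqNgt; apply/negP => cX.
have cA0 : (0 < #|` A|)%N by lia.
have [M [[MK M2 [U [UK U2 UM]]] cM M0 gsM]] :=
  two_atom (generated_subgroup A) (@mem_generated _ A) cA0 fX cX.
case: gsM => [gM|spM].
  have uM : exists2 u, generated A u & u \notin sumf A M.
    have [u uU] := cardf_gt0P _ (ltnW U2); exists u; first exact: UK.
    by rewrite sumfC UM.
  have [t tA /negP[]] := not_sub_subgroup gM A0 uM.
  by apply: (sparse_sub_subgroup spA gM (cardf_gt1_neq0 M2) A0) => //; rewrite sumfC; lia.
have := card_sparse_sumf2 spA M2; have := card_sparse_sumf2 spM (ltnW A3).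
have := @card_sparse_sumf3 A M spA; rewrite [sumf A M]sumfC.
by lia.
Qed.

Lemma two_fragment_dichotomy S X : 0 \in S -> (1 < #|` S|)%N ->
  fragment 2 (generated S) S X -> (#|` sumf X S| < #|` X| + #|` S|)%N ->
  (exists2 d, d != 0 & (#|` shift d S `\` S| <= 1)%N) \/
  exists H, [/\ subgroup [set` H], exists2 h, h \in H & h != 0,
    (#|` sumf S H| < #|` S| + #|` H|)%N & exists2 t, t \in S & t \notin H].
Proof.
move=> S0 S2 fX cX; pose K := generated S.
have gK : subgroup K := generated_subgroup S.
have [A [fA cA A0 gsA]] := two_atom gK (@mem_generated _ S) (ltnW S2) fX cX.
have [AK A2 [U [UK U2 UA]]] := fA.
have [u uU] := cardf_gt0P _ (ltnW U2).
case: gsA => [gA|spA].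
  right; exists A; rewrite sumfC addnC; split=> //; first exact: cardf_gt1_neq0.
  apply: not_sub_subgroup => //; exists u; first exact: UK.
  by rewrite sumfC UA.
have [A3|A3] := leqP #|` A| 2.
  (* Here [A] is the pair of [0] and [d], so the union of [S] and [d + S] has at most [|S| + 1]
     elements. *)
  left; have [d dA d0] := cardf_gt1_neq0 A2; exists d => //.
  have : (#|` S `|` shift d S| <= #|` sumf A S|)%N.
    apply: subset_cardf => y; rewrite inE mem_shift => /orP[yS|yS].
      by rewrite -(add0r y) mem_sumf.
    by rewrite -(subrK d y) addrC mem_sumf.
  have := cardfsUI S (shift d S); have := cardfsID S (shift d S).
  by rewrite [shift d S `&` S]fsetIC !card_shift; lia.
right; pose L := generated A.
have gL : subgroup L := generated_subgroup A.
have LK : (L `<=` K)%classic by apply: generated_sub.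
have nzA : exists2 h, h \in A & h != 0 by apply: cardf_gt1_neq0.
(* The subgroup generated by [A] is finite and has few holes, whether or not
   [A + S] is a union of its cosets. *)
suff : exists Y, (forall x, L x -> x \in Y) /\ forall H, (forall x, (x \in H) <-> L x) ->
    (#|` sumf S H| < #|` S| + #|` H|)%N /\ exists2 t, t \in S & t \notin H.
  case=> Y [LY good]; have [H [HL gH]] := finite_subgroup gL LY.
  have [cH tH] := good H HL; exists H; split=> //.
  by case: nzA => h hA h0; exists h => //; apply/HL; exact: mem_generated hA.
have [full|[s [l [sS Ll nsl]]]] : (forall s l, s \in S -> L l -> s + l \in sumf A S) \/
    exists s l, [/\ s \in S, L l & s + l \notin sumf A S].
  have [?|nE] := pselect (exists s l, [/\ s \in S, L l & s + l \notin sumf A S]).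
    by right.
  left=> s l sS Ll; apply/negPn/negP => nsl; apply: nE; by exists s, l.
(* Now [S + L] lies in [A + S], and [|A| <= |H|]. If [S] were inside [L], the missing point [u]
   would be in [L], hence in [A + S]. *)
- exists (sumf A S); split=> [x Lx|H HL]; first by rewrite -(add0r x) full.
  have SHA : {subset sumf S H <= sumf A S}.
    by move=> _ /sumfP[s [h [sS /HL Lh ->]]]; apply: full.
  have AH : {subset A <= H} by move=> a aA; apply/HL; exact: mem_generated aA.
  have := subset_cardf SHA; have := subset_cardf AH; split; first by lia.
  apply: contrapT => nE; have : u \notin sumf A S by apply: UA.
  rewrite -(add0r u) full //; have := UK _ uU; apply: generated_sub => // t tS.
  by apply/HL/negPn/negP => tH; apply: nE; exists t.
(* [S1] is the component in the coset [s + L], which [A + S] does not fill, so that its translate is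
   a 1-fragment for [A]. *)
pose S1 := [fset x in S | `[< L (x - s) >]].
have S1P x : reflect (x \in S /\ L (x - s)) (x \in S1).
  rewrite !inE; apply: (iffP andP) => -[xS Lx]; split=> //; exact/asboolP.
have S1S : {subset S1 <= S} by move=> x /S1P[].
have cS : (#|` S1| + #|` S `\` S1| = #|` S|)%N.
  rewrite -(cardfsID S1 S); congr (#|` _| + _)%N.
  by apply/fsetP => x; rewrite inE andb_idl // => /S1S.
have f1 : fragment 1 L A (shift (- s) S1).
  split=> [x||].
  - by rewrite mem_shift opprK => /S1P[_]; rewrite addrK.
  - rewrite card_shift; apply/cardf_gt0P; exists s; apply/S1P; rewrite subrr.
    by split=> //; apply: subgroup0.
  - exists [fset l]; rewrite cardfs1; split=> // x; rewrite inE => /eqP-> //.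
    apply: contra nsl; rewrite sumf_shiftl mem_shift opprK addrC sumfC.
    by apply: sumfS.
have := sparse_fragment1 spA A0 f1; rewrite sumf_shiftl !card_shift sumfC => c1.
have c2 : (#|` sumf A S1| + #|` sumf A (S `\` S1)| <= #|` sumf A S|)%N.
  apply: card_disjointU => [||x].
  - by apply: sumfS.
  - by apply: sumfS => // x; rewrite inE => /andP[].
  - case/sumfP => a [b [aA /S1P[bS Lb] ->]]; apply/negP => /sumfP[a' [b' [a'A]]].
    rewrite inE => /andP[/negP nb' b'S] e; apply: nb'; apply/S1P; split=> //.
    have -> : b' - s = a - a' + (b - s).
      by rewrite addrACA e addrACA subrr add0r.
    apply: (subgroupD gL) => //.
    by apply: (subgroupB gL); [exact: mem_generated aA|exact: mem_generated a'A].
(* By [c1] and [c2], the component [S1] uses up the whole excess of [A + S], so adding [A] to the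
   remainder does not enlarge it. *)
have perD : forall l, L l -> shift l (S `\` S1) = S `\` S1.
  apply: generated_sub; first exact: stabilizer_subgroup.
  move=> a aA /=.
  have subD : {subset S `\` S1 <= sumf A (S `\` S1)}.
    by move=> x xD; rewrite -(add0r x) mem_sumf.
  have eqD : S `\` S1 = sumf A (S `\` S1) by apply: subset_cardf_eq => //; lia.
  by apply: closed_shift => x xD; rewrite eqD addrC mem_sumf.
(* If nothing remains, then [S] lies in [L] and is a 2-fragment for [A], which [sparse_fragment2]
   excludes. *)
have [/eqP D0|D0] := posnP #|` S `\` S1|.
  have SS1 x : x \in S -> L (x - s).
    move=> xS; apply: contrapT => nLx; move: D0; rewrite cardfs_eq0 => /eqP D0.
    have : x \in S `\` S1 by rewrite inE xS andbT; apply/negP => /S1P[].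
    by rewrite D0.
  have Ls : L s by apply: (subgroupNE gL); rewrite -sub0r; apply: SS1.
  have SL x : x \in S -> L x by move=> xS; rewrite -(subrK s x); apply: (subgroupD gL) => //; exact: SS1.
  have KL : (K `<=` L)%classic by apply: generated_sub.
  have f2 : fragment 2 L A S.
    split=> //; exists U; split=> // v vU; first by apply: KL; exact: UK.
    by rewrite sumfC UA.
  by have := sparse_fragment2 spA A0 A3 f2; rewrite sumfC; lia.
have [t tD] := cardf_gt0P _ D0.
(* The remainder contains [t + L], so [L] is finite; all the holes are in [s + L], where [S] has a
   point. *)
exists (shift (- t) (S `\` S1)); split=> [x Lx|H HL].
  by rewrite -(perD _ Lx) shiftD mem_shift opprD opprK addrCA subrr addr0.
have gH : subgroup [set` H].
  by split=> [|x y /HL Lx /HL Ly]; apply/HL; [exact: (subgroup0 gL)|exact: (subgroupB gL)].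
split.
  have cov : {subset sumf S H <= (S `\` S1) `|` shift s H}.
    move=> _ /sumfP[x [h [xS hH ->]]]; rewrite !in_fsetU mem_shift.
    case: (boolP (x \in S1)) => [/S1P[_ /HL xH]|xS1]; apply/orP; [right|left].
      by rewrite addrAC; apply: (subgroupD gH).
    have /HL Lh := hH.
    by rewrite -(perD _ Lh) mem_shift addrK inE xS1.
  have := card_cover cov; rewrite card_shift.
  have : (0 < #|` S1|)%N.
    by apply/cardf_gt0P; exists s; apply/S1P; rewrite subrr; split=> //; apply: subgroup0.
  by lia.
apply: contrapT => nE.
have SH x : x \in S -> L x.
  by move=> xS; apply/HL/negPn/negP => xH; apply: nE; exists x.
move: tD; rewrite inE => /andP[/negP tS1 tS]; apply: tS1; apply/S1P; split=> //.
by apply: (subgroupB gL); apply: SH.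
Qed.

End TwoAtoms.

(** * Structure of the sets attaining Kneser's bound *)

Section Structure.
Local Open Scope fset_scope.
Local Open Scope ring_scope.
Variable G : zmodType.
Implicit Types (A B C H S X Y U : {fset G}) (K L : set G) (x y a b : G).

(* The last clause keeps [H] inside the coset in which an induction on the
   components of [S] takes place. *)
Definition reflective_component S H s0 x :=
  [/\ subgroup [set` H] /\ (exists2 h, h \in H & h != 0), s0 \in S,
      forall h, h \in H -> shift h (S `\` shift s0 H) = S `\` shift s0 H,
      forall y, (y \in S `&` shift s0 H) = (x - y \in shift s0 H `\` S)
    & forall L, subgroup L -> (forall u v, u \in S -> v \in S -> L (u - v)) ->
        forall h, h \in H -> L h].

(** Translating both [y] and [x - y] by [s] moves the reflection parameter by [2s]. *)
Lemma reflective_component_shift S H s0 x s :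
  reflective_component (shift (- s) S) H s0 x ->
  reflective_component S H (s + s0) (x + s + s).
Proof.
have shE : shift (s + s0) H = shift s (shift s0 H) by rewrite shiftD.
have SE : S = shift s (shift (- s) S) by rewrite shiftD subrr shift0.
case=> [[gH nzH] s0S per refl HL]; split=> //.
- by move: s0S; rewrite mem_shift opprK addrC.
- move=> h hH; rewrite shE {1}SE -shiftDf shiftD addrC -shiftD per //.
  by rewrite shiftDf -SE.
- move=> y; have := refl (y - s); rewrite shE !inE !mem_shift !opprK subrK.
  rewrite [_ + s + s - y - s]addrAC addrK opprB.
  by rewrite !addrA [x + s + s - y]addrAC.
- move=> L gL SL; apply: HL => // u v; rewrite !mem_shift !opprK => uS vS.
  by have := SL _ _ uS vS; rewrite opprD addrACA subrr addr0.
Qed.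

(** The set [u - S] is disjoint from [S] because [u] is not in [2S]. As the generated subgroup has
    [|2S| + 1 <= 2|S|] elements, [u - S] is the whole complement. *)
Lemma nearly_full_reflective S u : 0 \in S ->
  (1 < #|` S|)%N -> (#|` sumf S S| < 2 * #|` S|)%N ->
  generated S u -> u \notin sumf S S ->
  (forall v, generated S v -> v \notin sumf S S -> v = u) ->
  exists H, reflective_component S H 0 u.
Proof.
move=> S0 S1 cS Ku uS uniq.
have [|H [HK gH]] := finite_subgroup (X := u |` sumf S S) (generated_subgroup S).
  move=> x Kx; rewrite !inE; case: (boolP (x \in sumf S S)) => xS; rewrite ?orbT //.
  by rewrite (uniq x) ?eqxx.
have SH : {subset S <= H} by move=> s sS; apply/HK; exact: mem_generated.
pose R := [fset u - y | y in S].
have cR : #|` R| = #|` S| by rewrite [LHS]card_imfset // => y z /addrI /oppr_inj.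
have RH : {subset R <= H `\` S}.
  move=> _ /imfsetP[/= y yS ->]; rewrite inE; apply/andP; split.
    by apply: contra uS => uyS; rewrite -(subrK y u) mem_sumf.
  by apply: (subgroupB gH); [by apply/HK|exact: SH].
have RE : R = H `\` S.
  apply: subset_cardf_eq => //; rewrite cR.
  have : {subset H <= u |` sumf S S}.
    move=> x /HK Kx; rewrite !inE; case: (boolP (x \in sumf S S)) => xS; rewrite ?orbT //.
    by rewrite (uniq x) ?eqxx.
  move/subset_cardf; rewrite cardfsU1 uS; have := cardfsID S H.
  have -> : H `&` S = S by apply/fsetP => x; rewrite inE andb_idl //; apply: SH.
  by lia.
exists H; split=> //; first split=> //.
- case/cardf_gt1_neq0: S1 => s sS s0; exists s => //; exact: SH.
- move=> h hH; have -> : S `\` shift 0 H = fset0.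
    by apply/fsetP => x; rewrite shift0 !inE; case: (boolP (x \in S)) => [/SH->|_]; rewrite ?andbF.
  by apply/fsetP => x; rewrite mem_shift !inE.
- move=> y; rewrite shift0 -RE inE; apply/andP/imfsetP => /= [[yS _]|[z zS]].
    by exists y.
  by move=> /addrI /oppr_inj ->; split=> //; exact: SH.
- move=> L gL SL h /HK Kh; apply: (Kh L gL) => s sS.
  by rewrite -(subr0 s); apply: SL.
Qed.

(** The last clause gives that [H'] lies in [H], so the part of [S] outside [s0 + H] is
    [H']-periodic as well. *)
Lemma reflective_component_lift S H s0 H' s1 x : subgroup [set` H] ->
  (forall h, h \in H -> shift h (S `\` shift s0 H) = S `\` shift s0 H) ->
  reflective_component (S `&` shift s0 H) H' s1 x ->
  reflective_component S H' s1 x.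
Proof.
move=> gH per [[gH' nzH'] s1S per' refl H'L].
move: s1S; rewrite inE => /andP[s1S s1H].
have H'H : {subset H' <= H}.
  apply: (H'L _ gH) => u v; rewrite !inE !mem_shift => /andP[_ uH] /andP[_ vH] /=.
  by have := subgroupB gH uH vH; rewrite opprB addrA subrK.
have sub y : y \in shift s1 H' -> y \in shift s0 H.
  rewrite !mem_shift => /H'H yH; rewrite mem_shift in s1H.
  by have := subgroupD gH yH s1H; rewrite addrA subrK.
split=> //.
- move=> h hH'; apply: closed_shift => y; rewrite !inE => /andP[yH' yS].
  have nyh : y + h \notin shift s1 H'.
    apply: contra yH'; rewrite !mem_shift => yhH'.
    by have := subgroupB gH' yhH' hH'; rewrite addrAC addrK.
  rewrite nyh /=; case: (boolP (y \in shift s0 H)) => yH.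
    have : y + h \in (S `&` shift s0 H) `\` shift s1 H'.
      by rewrite -(per' h hH') mem_shift addrK !inE yH' yS.
    by rewrite !inE => /andP[_ /andP[]].
  have : y + h \in S `\` shift s0 H.
    by rewrite -(per h (H'H _ hH')) mem_shift addrK inE yH.
  by rewrite inE => /andP[].
- move=> y; have := refl y; rewrite !inE.
  have -> : (y \in S) && (y \in shift s1 H') =
      (y \in S) && (y \in shift s0 H) && (y \in shift s1 H').
    by case: (boolP (y \in shift s1 H')) => [/sub->|_]; rewrite ?andbT ?andbF.
  move=> ->; case: (boolP (x - y \in shift s1 H')) => [/sub->|_]; rewrite ?andbT ?andbF //.
- move=> L gL SL; apply: (H'L _ gL) => u v; rewrite !inE => /andP[uS _] /andP[vS _].
  exact: SL.
Qed.

(** Induction on [|S|]: a subgroup with few holes passes the equality to a smaller component, whose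
    structure lifts to [S]. *)
Theorem critical_structure k S : (exists g : G, g != 0) -> (0 < #|` S|)%N ->
  aperiodicf (nsum k.+2 S) -> (#|` nsum k.+2 S| + k.+1 = k.+2 * #|` S|)%N ->
  (exists2 d, d != 0 & (#|` shift d S `\` S| <= 1)%N) \/
  (k = 0 /\ exists H s0 x, reflective_component S H s0 x).
Proof.
move=> [g g0]; have [n] := ubnP #|` S|.
elim: n S => // n IHn S ltSn /cardf_gt0P[s sS] apS cS.
wlog S0 : S s sS ltSn apS cS / 0 \in S.
  move/(_ (shift (- s) S) 0); rewrite nsum_shift !card_shift mem_shift sub0r opprK.
  case=> //; first exact: aperiodicf_shift.
    case=> d d0; rewrite shiftD addrC -shiftD -shiftDf card_shift.
    by left; exists d.
  case=> k0 [H [s0 [x /reflective_component_shift ref]]].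
  by right; split=> //; exists H, (s + s0), (x + s + s).
have [S1|S1] := leqP #|` S| 1.
  left; exists g => //.
  by have := fsubset_leq_card (fsubsetDl (shift g S) S); rewrite card_shift; lia.
suff [good|[H [gH nzH holes tH]]] :
  ((exists2 d, d != 0 & (#|` shift d S `\` S| <= 1)%N) \/
   (k = 0 /\ exists H s0 x, reflective_component S H s0 x)) \/
  exists H, [/\ subgroup [set` H], exists2 h, h \in H & h != 0,
    (#|` sumf S H| < #|` S| + #|` H|)%N & exists2 t, t \in S & t \notin H].
- by [].
- have [s0 [s0S ltS0 apS0 cS0]] := quasiperiodic_reduction gH nzH holes S0 tH apS.
  have H0 : 0 \in H := subgroup0 gH.
  have S00 : (0 < #|` S `&` shift s0 H|)%N.
    by apply/cardf_gt0P; exists s0; rewrite inE s0S mem_shift subrr.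
  have kn := nsum_kneser S00 apS0.
  have cID := cardfsID (shift s0 H) S.
  have cD := card_sumfl (S `\` shift s0 H) H0.
  (* Equality for [S] forces equality both in Kneser's bound for the component and in
     [|D| <= |D + H|] for the remainder [D]. *)
  have DE : S `\` shift s0 H = sumf (S `\` shift s0 H) H.
    apply: subset_cardf_eq; last by nia.
    by move=> x xD; rewrite -(addr0 x) mem_sumf.
  have per h : h \in H -> shift h (S `\` shift s0 H) = S `\` shift s0 H.
    by move=> hH; apply: closed_shift => y yD; rewrite DE mem_sumf.
  have critS0 : (#|` nsum k.+2 (S `&` shift s0 H)| + k.+1 = k.+2 * #|` S `&` shift s0 H|)%N.
    by nia.
  have subD h : h \in H ->
      (#|` shift h S `\` S| <= #|` shift h (S `&` shift s0 H) `\` (S `&` shift s0 H)|)%N.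
    move=> hH; apply: subset_cardf => y; rewrite !(inE, mem_shift) => /andP[yS yhS].
    rewrite (negPf yS) yhS /=; apply: contraR yS => yhH.
    have : y \in S `\` shift s0 H by rewrite -(per h hH) mem_shift inE yhS andbT mem_shift.
    by rewrite inE => /andP[].
  have [S01|S01] := leqP #|` S `&` shift s0 H| 1.
    left; case: nzH => h hH h0; exists h => //; apply: leq_trans (subD h hH) _.
    by have := fsubset_leq_card (fsubsetDl (shift h (S `&` shift s0 H)) (S `&` shift s0 H));
      rewrite card_shift; lia.
  case: (IHn _ (leq_trans ltS0 ltSn) S00 apS0 critS0) => [[d d0 dS0]|[k0 [H' [s1 [x ref]]]]].
    left; exists d => //; apply: (leq_trans (subD d _) dS0).
    (* With two points or more, the component meets its translate by [d]; as it lies in one coset of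
       [H], this puts [d] in [H]. *)
    have /cardf_gt0P[y] : (0 < #|` shift d (S `&` shift s0 H) `&` (S `&` shift s0 H)|)%N.
      have := cardfsID (S `&` shift s0 H) (shift d (S `&` shift s0 H)).
      by rewrite card_shift; lia.
    rewrite !(inE, mem_shift) => /andP[/andP[_ ydH] /andP[_ yH]].
    by have := subgroupB gH yH ydH; rewrite !opprD !opprK addrACA addNr addr0 addrA subrr add0r.
  by right; split=> //; exists H', s1, x; apply: reflective_component_lift ref.
have [[j jk inc]|noj] := pselect (exists2 j, (1 <= j < k.+2)%N &
    (#|` nsum j.+1 S| + 1 < #|` nsum j S| + #|` S|)%N).
  by right; apply: small_increment_subgroup jk inc.
(* The increments from [2S] on are at least [|S| - 1]; removing them from the critical equality
   leaves [|2S| <= 2|S| - 1]. *)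
have c2S : (#|` sumf S S| < 2 * #|` S|)%N.
  have : forall j, (2 <= j < 2 + k)%N -> (#|` nsum j S| + #|` S| <= #|` nsum j.+1 S| + 1)%N.
    by move=> j jk; rewrite leqNgt; apply/negP => inc; apply: noj; exists j => //; lia.
  move/nsum_increments; rewrite add2n.
  have -> : nsum 2 S = sumf S S by rewrite /= sumf0.
  by lia.
have [u Ku uS] := aperiodicf_not_full S1 apS.
have frag U : (forall v, v \in U -> generated S v) -> (1 < #|` U|)%N ->
    (forall v, v \in U -> v \notin sumf S S) -> fragment 2 (generated S) S S.
  by move=> UK U2 US; split=> //; [exact: mem_generated|exists U].
have [[U [UK U2 US]]|noU] := pselect (exists U, [/\ forall v, v \in U -> generated S v,
    (1 < #|` U|)%N & forall v, v \in U -> v \notin sumf S S]).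
  have cSS : (#|` sumf S S| < #|` S| + #|` S|)%N by lia.
  by case: (two_fragment_dichotomy S0 S1 (frag U UK U2 US) cSS) => [?|?]; [left; left|right].
left; right.
have k0 : k = 0.
  (* As [u] is outside the full multiple, [u - kS] avoids [2S], and for positive [k] it has at least
     [|S|] points. *)
  apply: contrapT => k0; apply: noU; exists [fset u - z | z in nsum k S]; split.
  - move=> _ /imfsetP[/= z zS ->]; apply: (subgroupB (generated_subgroup S)) => //.
    exact: nsum_generated zS.
  - rewrite card_imfset /=; last by move=> y z /addrI /oppr_inj.
    by apply: leq_trans S1 _; apply: card_nsum_ge; lia.
  - move=> _ /imfsetP[/= z zS ->]; apply: contra uS => uzS.
    rewrite -(subrK z u) -[nsum k.+2 S]/(sumf S (sumf S (nsum k S))) sumfA.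
    exact: mem_sumf.
split=> //; have uS2 : u \notin sumf S S by move: uS; rewrite k0 /= sumf0.
have [H ref] : exists H, reflective_component S H 0 u.
  apply: nearly_full_reflective => // v Kv vS; apply/eqP/negPn/negP => vu; apply: noU.
  exists [fset u; v]; rewrite cardfs2 eq_sym vu; split=> // w.
    by rewrite !inE => /orP[]/eqP->.
  by rewrite !inE => /orP[]/eqP->.
by exists H, 0, u.
Qed.

End Structure.

(** * Splitting off a progression *)

Section Progression.
Local Open Scope fset_scope.
Local Open Scope ring_scope.
Variable G : zmodType.
Implicit Types (A B S X : {fset G}) (K L : set G) (x y a b d : G).

Lemma progression_component S d : (#|` shift d S `\` S| <= 1)%N -> shift d S <> S ->
  exists a m A, [/\ forall y, (y \in A) <-> exists2 i, (i < m.+1)%N & y = a + d *+ i,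
    {subset A <= S}, a \in A & shift d (S `\` A) = S `\` A].
Proof.
move=> card1 notper.
have [e eS edS] : exists2 e, e \in S & e + d \notin S.
  apply: contrapT => nE; apply: notper; apply: closed_shift => y yS.
  by apply/negPn/negP => ydS; apply: nE; exists y.
have uniq y : y \in S -> y + d \notin S -> y = e.
  move=> yS ydS; apply/eqP/negPn/negP => ye.
  suff : (1 < #|` shift d S `\` S|)%N by lia.
  apply/cardf_gt1P; exists (y + d), (e + d); rewrite !inE !mem_shift !addrK.
  by rewrite ydS edS; split=> //; apply: contra ye => /eqP/addIr->.
(* Going back from [e] by steps of [d] leaves [S]: otherwise the finite set [T] would be stable
   under [- d], hence would contain [e + d]. *)
have exP : exists i, e - d *+ i.+1 \notin S.
  apply: contrapT => nE.
  have inS i : e - d *+ i \in S.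
    case: i => [|i]; first by rewrite mulr0n subr0.
    by apply/negPn/negP => ni; apply: nE; exists i.
  pose T := [fset y in S | `[< exists i, y = e - d *+ i >]].
  have TP i : e - d *+ i \in T by rewrite !inE inS /=; apply/asboolP; exists i.
  have perT : shift (- d) T = T.
    apply: closed_shift => y; rewrite !inE => /andP[_ /asboolP[i ->]].
    by rewrite -addrA -opprD -mulrSr; move: (TP i.+1); rewrite !inE.
  have : e + d \in T by rewrite -[d]opprK -mem_shift perT -(subr0 e) -(mulr0n d).
  by rewrite !inE (negPf edS).
case: (ex_minnP exP) => m mS minm.
have inS i : (i <= m)%N -> e - d *+ i \in S.
  case: i => [|i] im; first by rewrite mulr0n subr0.
  by apply/negPn/negP => /minm; lia.
have [I IP] : exists I : {fset nat}, forall i, (i \in I) = (i < m.+1)%N.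
  by exists [fset j in iota 0 m.+1] => i; rewrite in_fset mem_iota.
pose a := e - d *+ m; pose A := [fset a + d *+ i | i in I].
have AP y : (y \in A) <-> exists2 i, (i < m.+1)%N & y = a + d *+ i.
  split=> [/imfsetP[i /=]|[i im ->]]; first by rewrite IP => im ->; exists i.
  by apply/imfsetP; exists i; rewrite //= IP.
have aE i : (i <= m)%N -> a + d *+ i = e - d *+ (m - i).
  by move=> im; rewrite /a -[in d *+ m](subnK im) mulrnDr opprD addrA subrK.
have eA : e \in A by apply/AP; exists m => //; rewrite aE // subnn mulr0n subr0.
exists a, m, A; split=> //.
- by move=> y /AP[i im ->]; rewrite aE // inS // leq_subr.
- by apply/AP; exists 0%N => //; rewrite mulr0n addr0.
(* A point outside [A] whose successor is in [A] can only be [a - d], which is not in [S]; and only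
   [e], which is in [A], has its successor outside [S]. *)
- apply: closed_shift => y; rewrite !inE => /andP[yA yS]; apply/andP; split.
    apply: contra yA => /AP[[|i] im ye].
      case/negP: mS; rewrite mulrSr opprD addrA -/a.
      by move: ye; rewrite mulr0n addr0 => <-; rewrite addrK.
    apply/AP; exists i; first by lia.
    by apply: (addIr d); rewrite ye mulrSr addrA.
  apply/negPn/negP => ydS; case/negP: yA.
  by rewrite (uniq y yS ydS).
Qed.

End Progression.

(** * Passing to finite sets, and counting in quotients *)

Section Transfer.
Local Open Scope fset_scope.
Local Open Scope ring_scope.
Variable G : zmodType.
Implicit Types (A B S X H : {fset G}) (K L : set G) (x y a b d : G).

Lemma set_cardE (T : choiceType) (A : {fset T}) : set_card [set` A] = #|` A|.
Proof. by rewrite /set_card set_fsetK. Qed.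

Lemma translateE x A : translate x [set` A] = [set` shift x A].
Proof.
apply/seteqP; split=> y /=; first by case=> a aA <-; rewrite mem_shift addrC addKr.
by rewrite mem_shift => yA; exists (y - x) => //; rewrite addrC subrK.
Qed.

Lemma sumsetE A B : sumset [set` A] [set` B] = [set` sumf A B].
Proof.
apply/seteqP; split=> y /=; first by case=> a aA [b bB <-]; rewrite mem_sumf.
by case/sumfP => a [b [aA bB ->]]; exists a => //; exists b.
Qed.

Lemma ksumsetE k A : ksumset k.+1 [set` A] = [set` nsum k.+1 A].
Proof.
elim: k => [|k IHk]; first by rewrite nsum1.
by rewrite -[ksumset k.+2 _]/(sumset [set` A] (ksumset k.+1 [set` A])) IHk sumsetE.
Qed.

Lemma aperiodicE A : aperiodic [set` A] -> aperiodicf A.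
Proof.
move=> /seteqP[apA _] x xA; apply: apA => /=.
by rewrite translateE xA.
Qed.

Lemma subgroup_zmodClosed K : subgroup K ->
  exists H : zmodClosed G, forall x, (x \in H) <-> K x.
Proof.
move=> gK; pose P : {pred G} := fun x => `[< K x >].
have clP : zmod_closed P.
  split=> [|x y /asboolP Kx /asboolP Ky]; apply/asboolP; first exact: subgroup0.
  exact: subgroupB.
pose m := GRing.isZmodClosed.Build G P clP.
pose H : zmodClosed G := HB.pack P m.
by exists H => x; split=> /asboolP.
Qed.

Lemma quotient_map_add (H : zmodClosed G) x y :
  quotient_map H (x + y) = quotient_map H x + quotient_map H y.
Proof. by rewrite /quotient_map piE. Qed.

Lemma quotient_map_eq (H : zmodClosed G) x y :
  (quotient_map H x == quotient_map H y) = (x - y \in H).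
Proof. by rewrite Quotient.idealrBE. Qed.

Definition quotf (H : zmodClosed G) A : {fset Quotient.quot H} :=
  [fset quotient_map H x | x in A].

Lemma quotfP (H : zmodClosed G) A p :
  reflect (exists2 x, x \in A & p = quotient_map H x) (p \in quotf H A).
Proof. exact: imfsetP. Qed.

Lemma quotfE (H : zmodClosed G) A : (quotient_map H @` [set` A])%classic = [set` quotf H A].
Proof.
apply/seteqP; split=> p /=; first by case=> x xA <-; apply/quotfP; exists x.
by case/quotfP => x xA ->; exists x.
Qed.

Lemma quotf_sumf (H : zmodClosed G) A B :
  quotf H (sumf A B) = sumf (quotf H A) (quotf H B).
Proof.
apply/fsetP => p; apply/quotfP/sumfP.
  case=> _ /sumfP[a [b [aA bB ->]]] ->; exists (quotient_map H a), (quotient_map H b).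
  by rewrite quotient_map_add; split=> //; apply/quotfP; [exists a|exists b].
case=> _ [_ [/quotfP[a aA ->] /quotfP[b bB ->] ->]].
by exists (a + b); rewrite ?mem_sumf ?quotient_map_add.
Qed.

Lemma quotf_nsum (H : zmodClosed G) k A : quotf H (nsum k.+1 A) = nsum k.+1 (quotf H A).
Proof.
elim: k => [|k IHk]; first by rewrite !nsum1.
by rewrite -[nsum k.+2 A]/(sumf A (nsum k.+1 A)) quotf_sumf IHk.
Qed.

(** Components are removed one at a time: each accounts for one coset in [A + H] and one point of
    the quotient. *)
Lemma card_quotf (H : zmodClosed G) (Hf : {fset G}) A : (forall x, (x \in Hf) = (x \in H)) ->
  (#|` sumf A Hf| = #|` quotf H A| * #|` Hf|)%N.
Proof.
move=> HE; have [n] := ubnP #|` A|; elim: n A => // n IHn A ltAn.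
have [/cardfs0_eq ->|/cardf_gt0P[a aA]] := posnP #|` A|.
  have -> : sumf fset0 Hf = fset0 by apply/fsetP => x; apply/sumfP => -[a [b []]].
  have -> : quotf H fset0 = fset0 by apply/fsetP => x; apply/quotfP => -[a].
  by rewrite !cardfs0 mul0n.
pose B := A `\` shift a Hf.
have inB x : (x \in B) = (x \in A) && (x - a \notin H).
  by rewrite inE mem_shift HE andbC.
have cB : (#|` B| < #|` A|)%N.
  have := @card_disjointU _ [fset a] B A; rewrite cardfs1; apply.
  - by move=> x; rewrite inE => /eqP->.
  - by move=> x; rewrite inB => /andP[].
  - by move=> x; rewrite inE inB => /eqP->; rewrite subrr rpred0 andbF.
have sumE : sumf A Hf = shift a Hf `|` sumf B Hf.
  apply/fsetP => x; rewrite in_fsetU mem_shift HE; apply/sumfP/orP.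
    move=> [y [h [yA hH ->]]]; rewrite HE in hH.
    case: (boolP (y - a \in H)) => yH; [left|right].
      by rewrite addrAC rpredD.
    by apply: mem_sumf; rewrite ?inB ?yA // HE.
  case=> [xH|/sumfP[y [h [+ hH ->]]]]; last by rewrite inB => /andP[yA _]; exists y, h.
  by exists a, (x - a); rewrite HE [a + _]addrC subrK.
have quotE : quotf H A = quotient_map H a |` quotf H B.
  apply/fsetP => p; rewrite in_fset1U; apply/quotfP/orP.
    move=> [y yA ->]; case: (boolP (y - a \in H)) => yH; [left|right].
      by rewrite quotient_map_eq.
    by apply/quotfP; exists y; rewrite ?inB ?yA.
  case=> [/eqP->|/quotfP[y + ->]]; first by exists a.
  by rewrite inB => /andP[yA _]; exists y.
have I0 : shift a Hf `&` sumf B Hf = fset0.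
  apply/fsetP => x; rewrite in_fsetI mem_shift HE in_fset0; apply/negP => /andP[xH].
  case/sumfP => y [h [+ hH xe]]; rewrite inB HE in hH * => /andP[_ /negP]; apply.
  by have := rpredB xH hH; rewrite xe [y + h - a]addrAC addrK.
have aB : quotient_map H a \notin quotf H B.
  apply/quotfP => -[y + /eqP]; rewrite quotient_map_eq inB => /andP[_ yH].
  by rewrite -opprB rpredN (negPf yH).
have := cardfsUI (shift a Hf) (sumf B Hf).
rewrite I0 cardfs0 addn0 card_shift -sumE => ->.
by rewrite IHn ?quotE ?cardfsU1 ?aB ?mulnDl ?mul1n //; lia.
Qed.

Lemma nsum_fset1 k x : nsum k [fset x] = [fset x *+ k].
Proof.
elim: k => [|k IHk] //=; rewrite IHk; apply/fsetP => y; rewrite inE mulrS.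
apply/sumfP/eqP => [[a [b []]]|->]; first by rewrite !inE => /eqP-> /eqP->.
by exists x, (x *+ k); rewrite !inE.
Qed.

End Transfer.

(** * Cardinalities for the component and for the quotient image *)

Section Decomposition.
Local Open Scope fset_scope.
Local Open Scope ring_scope.

(** An empty remainder makes the quotient image a point. Otherwise Kneser's bound for [A] and the
    unique expression bound must both be equalities, and dividing the second by [|H|] gives the
    count in the quotient. *)
Lemma decomposition_cards (G : zmodType) (K : set G) (H : zmodClosed G) k (S A : {fset G}) s0 :
  subgroup K -> (forall x, (x \in H) <-> K x) -> (exists2 h, K h & h != 0) ->
  s0 \in S -> (forall y, (y \in A) <-> y \in S /\ K (y - s0)) ->
  (forall h, K h -> shift h (S `\` A) = S `\` A) ->
  aperiodicf (nsum k.+2 S) -> (#|` nsum k.+2 S| + k.+1 = k.+2 * #|` S|)%N ->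
  (#|` nsum k.+2 A| + k.+1 = k.+2 * #|` A|)%N /\
  (#|` nsum k.+2 (quotf H S)| + k.+1 = k.+2 * #|` quotf H S|)%N.
Proof.
move=> gK HK nzK s0S AP per apS cS.
have AS : {subset A <= S} by move=> y /AP[].
have s0A : s0 \in A by apply/AP; rewrite subrr; split=> //; apply: subgroup0.
have [D0|/cardf_gt0P[t tD]] := posnP #|` S `\` A|.
  have SA : {subset S <= A}.
    move=> x xS; apply/negPn/negP => xA; move/cardfs0_eq/fsetP/(_ x): D0.
    by rewrite inE xA xS.
  have -> : A = S by apply/fsetP => x; apply/idP/idP => [/AS|/SA].
  split=> //; have -> : quotf H S = [fset quotient_map H s0].
    apply/fsetP => p; rewrite inE; apply/quotfP/eqP => [[x /SA/AP[_ Kx] ->]|->].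
      by apply/eqP; rewrite quotient_map_eq; apply/HK.
    by exists s0.
  by rewrite nsum_fset1 !cardfs1; lia.
(* The periodic remainder contains [t + K], so [K] is finite. *)
have [|Hf [HfK gHf]] := finite_subgroup (X := shift (- t) (S `\` A)) gK.
  by move=> x Kx; rewrite -(per _ Kx) shiftD mem_shift opprD opprK addrCA subrr addr0.
have AE : A = S `&` shift s0 Hf.
  apply/fsetP => y; rewrite inE mem_shift; apply/idP/andP => [/AP[yS /HfK]//|[yS /HfK Ky]].
  exact/AP.
have DE : S `\` A = S `\` shift s0 Hf.
  by apply/fsetP => y; rewrite AE !inE; case: (y \in S); rewrite ?andbF.
have nzHf : exists2 h, h \in Hf & h != 0.
  by case: nzK => h /HfK hH h0; exists h.
have per2 u v h : u \in S -> u \notin shift s0 Hf -> v \in S -> h \in Hf ->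
    u + v + h \in sumf S S.
  move=> uS uH vS /HfK Kh; rewrite addrAC mem_sumf //.
  have : u + h \in S `\` A by rewrite -(per h Kh) mem_shift addrK DE inE uH.
  by rewrite inE => /andP[].
have [apA c1 c2] := quasiperiodic_nsum gHf nzHf s0S per2 apS.
rewrite -AE -DE in apA c1 c2.
have A0 : (0 < #|` A|)%N by apply/cardf_gt0P; exists s0.
have kn := nsum_kneser A0 apA.
have Hf0 : 0 \in Hf := subgroup0 gHf.
have cID : (#|` A| + #|` S `\` A| = #|` S|)%N.
  rewrite -(cardfsID A S); congr (#|` _| + _)%N.
  by apply/fsetP => x; rewrite inE andb_idl // => /AS.
have DH := card_sumfl (S `\` A) Hf0.
have critA : (#|` nsum k.+2 A| + k.+1 = k.+2 * #|` A|)%N by nia.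
split=> //.
have HfH x : (x \in Hf) = (x \in H) by apply/idP/idP => [/HfK/HK|/HK/HfK].
have := card_quotf (nsum k.+2 S) HfH; rewrite quotf_nsum.
have := card_quotf S HfH.
have sumE : sumf S Hf = shift s0 Hf `|` (S `\` A).
  apply/fsetP => x; rewrite in_fsetU mem_shift; apply/sumfP/orP.
    move=> [y [h [yS hH ->]]]; case: (boolP (y \in A)) => yA; [left|right].
      have /AP[_ /HfK yH] := yA.
      by rewrite addrAC; apply: (subgroupD gHf).
    have /HfK Kh := hH.
    by rewrite -(per h Kh) mem_shift addrK inE yA.
  case=> [xH|xD]; first by exists s0, (x - s0); rewrite [s0 + _]addrC subrK.
  by exists x, 0; rewrite addr0; split=> //; move: xD; rewrite inE => /andP[].
have := cardfsUI (shift s0 Hf) (S `\` A).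
have -> : shift s0 Hf `&` (S `\` A) = fset0.
  by apply/fsetP => x; rewrite DE !inE; case: (x \in shift s0 Hf).
rewrite -sumE cardfs0 addn0 card_shift => -> cq ckq.
have Hfp : (0 < #|` Hf|)%N by apply/cardf_gt0P; exists 0.
move: cq ckq c1 critA cID cS kn; move: #|` nsum k.+2 (quotf H S)| #|` quotf H S| => q r.
move=> cq ckq c1 critA cID cS _.
(* Here [q * |Hf|] is the size of the multiple plus [Hf], and by [cq] the product [r * |Hf|] is
   [|Hf| + |S \ A|]. *)
have e1 : (q * #|` Hf| = #|` Hf| + k.+2 * #|` S `\` A|)%N by nia.
apply/eqP; rewrite -(eqn_pmul2r Hfp); apply/eqP; nia.
Qed.

End Decomposition.

(** * Assembly of the decomposition *)

Theorem corollary14 (G : zmodType) (G_neq0 : exists g : G, g != 0)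
    (k : nat) (k_ge2 : (2 <= k)%N) (S : set G) (S_fin : finite_set S)
    (kS_aper : aperiodic (ksumset k S))
    (kS_card : (set_card (ksumset k S))%:Z = k%:Z * (set_card S)%:Z - k%:Z + 1) :
  exists (H : zmodClosed G) (S0 : set G),
    [/\ [set` H] != [set 0],
        component [set` H] S S0,
        sumset (S `\` S0) [set` H] = S `\` S0,
        (set_card (ksumset k S0))%:Z = k%:Z * (set_card S0)%:Z - k%:Z + 1
          /\ (set_card (ksumset k (quotient_map H @` S)))%:Z
               = k%:Z * (set_card (quotient_map H @` S))%:Z - k%:Z + 1
      & arithmetic_progression S0
        \/ (k = 2%N
            /\ exists x : G,
                 S0 = reflection x (sumset S0 [set` H] `\` S0))].
Proof.
case: k k_ge2 kS_aper kS_card => [|[|k]] // _.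
have /finite_fsetP[A ->] := S_fin.
rewrite ksumsetE !set_cardE => /aperiodicE apA cA.
have A0 : (0 < #|` A|)%N.
  rewrite lt0n; apply/eqP => /cardfs0_eq A0; case: G_neq0 => g /eqP; apply; apply: apA.
  have -> : nsum k.+2 A = fset0 by rewrite A0; apply/fsetP => x; apply/sumfP => -[a [b []]].
  by apply/fsetP => x; rewrite mem_shift.
have {}cA : (#|` nsum k.+2 A| + k.+1 = k.+2 * #|` A|)%N by lia.
(* [K] stays a predicate because in the progression case it is generated by [d], which may have
   infinite order. *)
suff [K [B [s0 [gK nzK s0A [BP per] last]]]] : exists K (B : {fset G}) s0,
  [/\ subgroup K, exists2 h, K h & h != 0, s0 \in A,
      (forall y, (y \in B) <-> y \in A /\ K (y - s0)) /\
      (forall h, K h -> shift h (A `\` B)%fset = (A `\` B)%fset)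
    & arithmetic_progression [set` B] \/
      (k = 0%N /\ exists x, forall y, (y \in B) <-> K (x - y - s0) /\ x - y \notin B)].
  have [H HK] := subgroup_zmodClosed gK.
  have [cB cQ] := decomposition_cards gK HK nzK s0A BP per apA cA.
  have DE : [set` A] `\` [set` B] = [set` (A `\` B)%fset].
    apply/seteqP; split=> x /=; rewrite inE; first by case=> -> /negP->.
    by case/andP => /negP.
  have s0B : s0 \in B by apply/BP; rewrite subrr; split=> //; apply: subgroup0.
  exists H, [set` B]; split.
  - case: nzK => h /HK hH h0; apply/eqP => /seteqP[/(_ h hH) /= h00 _].
    by rewrite h00 eqxx in h0.
  - split; first by exists s0.
    exists s0; apply/seteqP; split=> y /=.
      by case/BP => yA /HK yH; split=> //; exists (y - s0) => //; rewrite addrC subrK.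
    case=> yA [h /HK Kh ye]; apply/BP; split=> //.
    by rewrite -ye addrC addKr.
  - rewrite DE; apply/seteqP; split=> y /=.
      case=> x xD [h /HK Kh <-]; by rewrite -(per h Kh) mem_shift addrK.
    move=> yD; exists y => //; exists 0; rewrite ?addr0 //; exact: rpred0.
  - by rewrite quotfE !ksumsetE !set_cardE; split; lia.
  - case: last => [|[k0 [x xP]]]; [by left|right; rewrite k0; split=> //; exists x].
    apply/seteqP; split=> y /=.
      move=> /xP[Kxy xyB]; exists (x - y); last by rewrite opprB addrC subrK.
      split; last exact/negP.
      by exists s0 => //; exists (x - y - s0); [apply/HK|rewrite addrC subrK].
    case=> z [[b bB [h /HK Kh zE]] zB] <-; apply/xP; rewrite opprB [x + _]addrC subrK.
    split; last exact/negP.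
    have /BP[_ Kb] := bB; rewrite -zE addrAC; exact: subgroupD.
have [[d d0 dA]|[k0 [H [s0 [x [[gH nzH] s0A per refl _]]]]]] := critical_structure G_neq0 A0 apA cA.
  have npA : shift d A <> A.
    move=> dAA; case/eqP: d0; apply: apA.
    by rewrite -[nsum k.+2 A]/(sumf A (nsum k.+1 A)) -sumf_shiftl dAA.
  have [a [m [B [BP BA aB per]]]] := progression_component dA npA.
  have gK := generated_subgroup [fset d]%fset.
  have Kd : generated [fset d]%fset d by apply: mem_generated; rewrite inE.
  have {}per h : generated [fset d]%fset h -> shift h (A `\` B)%fset = (A `\` B)%fset.
    move: h; apply: generated_sub; first exact: stabilizer_subgroup.
    by move=> s; rewrite inE => /eqP->.
  exists (generated [fset d]%fset), B, a; split=> //; first by exists d.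
  - exact: BA.
  - split=> // y; split=> [yB|[yA Ky]].
      split; first exact: BA.
      have /BP[i _ ->] := yB; rewrite addrC addKr.
      elim: i => [|i IHi]; first by rewrite mulr0n; apply: (subgroup0 gK).
      by rewrite mulrS; apply: (subgroupD gK).
    (* If [y] were in the remainder, its periodicity would put [a] there too, although [a] is in
       [B]. *)
    apply/negPn/negP => yB; have : a \in (A `\` B)%fset.
      by rewrite -(per _ (subgroupN gK Ky)) mem_shift opprK addrC subrK inE yB.
    by rewrite inE aB.
  - left; exists a, d, m; apply/seteqP; split=> y /=; first by case/BP => i im ->; exists i.
    by case=> i im <-; apply/BP; exists i.
have DE : (A `\` (A `&` shift s0 H) = A `\` shift s0 H)%fset.
  by apply/fsetP => y; rewrite !inE; case: (y \in A); rewrite ?andbF.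
exists [set` H], (A `&` shift s0 H)%fset, s0; split=> //.
- split=> [y|h hH]; last by rewrite DE; apply: per.
  by rewrite inE mem_shift; split=> [/andP[]|[-> ->]].
- right; split=> //; exists x => y; rewrite refl !inE !mem_shift.
  by split=> [/andP[xyA xyH]|[xyH]]; rewrite /= xyH ?andbT ?(negPf xyA).
Qed.
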